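(* Let $\alpha>0$, $p^*>0$, $\gamma>0$. Let $f^\lambda_\delta=L^\lambda y^\delta$, where $y^\delta$ is such that $\|y^\delta-y\|\le\delta$, let $\lambda=\lambda_\delta=\Theta(\delta^{p^*})$ and $\varepsilon(\lambda)=\Theta(\lambda^\gamma)$, and suppose that the lower rate of the error with respect to the noise level $\delta\to0$ is $\delta^\alpha$, i.e. $$\|f^{\lambda_\delta}_\delta-f^\dagger\|^2\in\Omega(\delta^\alpha).$$ Then the average lower rate with respect to the number of samples $n\to\infty$ is given by $$\mathbb E\left(\|\hat f^\lambda_n-f^\dagger\|^2\right)\in\begin{cases}\Omega\left(n^{-\frac{\alpha}{2}}\right)&\text{if }p^*\gamma\ge1,\\ \Omega\left(n^{-\frac{\alpha}{1+p^*\gamma}}\right)&\text{if }p^*\gamma<1,\end{cases}$$ where $\lambda=\lambda_n$ is the parameter choice associated with $\lambda_\delta$ (defined in the context), which has the rate $$\lambda_n\in\begin{cases}\Theta\left(n^{-\frac{p^*}{2}}\right)&\text{if }p^*\gamma\ge1,\\ \Theta\left(n^{-\frac{p^*}{1+p^*\gamma}}\right)&\text{if }p^*\gamma<1.\end{cases}$$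
   Context: Setting. $\mathcal H_1=L^2(\mathcal T,\mu)$ for a measure space $(\mathcal T,\Theta,\mu)$ and $\mathcal H_2=L^2(\mathcal X,\nu)$ for a measure space $(\mathcal X,\Sigma,\nu)$; $A:\mathcal H_1\to\mathcal H_2$ is a bounded linear operator. $(L^\lambda)_{\lambda>0}$ is a family of linear regularization operators $\mathcal H_2\to\mathcal H_1$ for $A$, of the form $L^\lambda z=\int_{\mathcal X}\ell^\lambda_x\,z(x)\,d\nu(x)$, where $\ell^\lambda_x\in\mathcal H_1$ for each $x$, $\ell^\lambda_x(t)=\ell^\lambda(x,t)$, $\ell^\lambda(\cdot,t)\in\mathcal H_2$ for each $t\in\mathcal T$, and $\sup_{t\in\mathcal T}\|\ell^\lambda(\cdot,t)\|_{\mathcal H_2}<\infty$. $\|\cdot\|_{HS}$ is the Hilbert–Schmidt norm. $f^\lambda=L^\lambda y$ and $\hat f^\lambda_n=\frac1n\sum_{i=1}^n\ell^\lambda_{X_i}Y_i$. Samples. The observations $(X_i,Y_i)$, $i=1,\dots,n$, are i.i.d. from a probability distribution $\rho$ on a Borel space $\mathcal X\times\mathcal Y$, $\mathcal Y\subseteq\mathbb R$, with marginal $\nu$ on $\mathcal X$; for $\nu$-almost every $x$, $\mathbb E(Y|X=x)=Af^\dagger(x)=y(x)$, where $f^\dagger\in\mathcal H_1$ is the generalized (minimum-norm least-squares) solution of $y=Af$, and $Var(Y|X=x)=\sigma^2$ with $\sigma$ constant. $\mathbb E$ is the expectation with respect to $\rho^{\otimes n}$. Notation. $\varepsilon(\lambda)=\|f^\lambda-f^\dagger\|\,\|L^\lambda\|_{HS}^{-1}$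 (asymptotics as $\lambda\to0$), $$\Delta(n,\lambda)=\frac{1}{\sqrt{\frac{\sigma^2}{n}+\varepsilon(\lambda)^2}+\varepsilon(\lambda)}\,\frac{\sigma^2}{n},\qquad N(\delta,\lambda)=\frac{\sigma^2}{\delta^2+2\delta\varepsilon(\lambda)}.$$ For a choice $\lambda_n$ put $\tilde\delta(n):=\Delta(n,\lambda_n)$; for a choice $\lambda_\delta$ put $\tilde n(\delta):=\lfloor N(\delta,\lambda_\delta)\rfloor$. Write $\lambda_n=\Lambda^n(n)$ and $\lambda_\delta=\Lambda^\delta(\delta)$. The parameter choice $\lambda_n$ associated with a given $\lambda_\delta$ is the one such that $\tilde n\circ\tilde\delta=id_{\mathbb N}$ and $\Lambda^\delta=\Lambda^n\circ\tilde n$ (equivalently $\lambda_n=\Lambda^\delta(\tilde\delta(n))$ with $\tilde\delta(n)=\Delta(n,\lambda_n)$); it then also satisfies $\tilde\delta\circ\tilde n=id_{\Im(\tilde\delta)}$, where $\Im(\tilde\delta)=\{\delta>0 : \frac{\sigma^2}{\delta^2+2\delta\varepsilon(\lambda_\delta)}\in\mathbb N\}$. $\Omega,\Theta$ are the usual Landau symbols ($h\in\Omega(k)$ means $h\ge M k$ asymptotically for some constant $M>0$). *)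

(* Defs.v *)
(* The elements of L^2 are represented by functions in
   [Lfun mu 2%:E], not by their classes modulo a.e. equality. *)
From HB Require Import structures.
From mathcomp Require Import all_boot all_order all_algebra.
From mathcomp Require Import all_classical all_reals all_analysis.

Set Implicit Arguments.
Unset Strict Implicit.
Unset Printing Implicit Defensive.

Import Order.TTheory GRing.Theory Num.Theory.
Import numFieldNormedType.Exports.

Local Open Scope classical_set_scope.
Local Open Scope ring_scope.

Section L2.
Context {R : realType}.

Definition L2norm d (T : measurableType d) (mu : {measure set T -> \bar R})
    (f : T -> R) : R := fine ('N[mu]_2%:E[EFin \o f])%E.

Definition L2dot d (T : measurableType d) (mu : {measure set T -> \bar R})
    (f g : T -> R) : R := \int[mu]_x (f x * g x).

(* Linearity and the bound make such a map compatible with a.e. equality, so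
   that it induces a bounded operator L^2(mu) -> L^2(nu). *)
Definition bounded_linear_L2 d1 d2 (T : measurableType d1)
    (X : measurableType d2) (mu : {measure set T -> \bar R})
    (nu : {measure set X -> \bar R}) (A : (T -> R) -> (X -> R)) : Prop :=
  [/\ forall f, f \in Lfun mu 2%:E -> A f \in Lfun nu 2%:E,
      forall (a : R) f g, f \in Lfun mu 2%:E -> g \in Lfun mu 2%:E ->
        A (fun t => a * f t + g t) = (fun x => a * A f x + A g x) %[ae nu]
    & exists C : R, forall f, f \in Lfun mu 2%:E ->
        L2norm nu (A f) <= C * L2norm mu f].

Definition least_squares_solution d1 d2 (T : measurableType d1)
    (X : measurableType d2) (mu : {measure set T -> \bar R})
    (nu : {measure set X -> \bar R}) (A : (T -> R) -> (X -> R))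
    (y : X -> R) (f : T -> R) : Prop :=
  f \in Lfun mu 2%:E /\
  forall g, g \in Lfun mu 2%:E -> L2norm nu (A f \- y) <= L2norm nu (A g \- y).

Definition generalized_solution d1 d2 (T : measurableType d1)
    (X : measurableType d2) (mu : {measure set T -> \bar R})
    (nu : {measure set X -> \bar R}) (A : (T -> R) -> (X -> R))
    (y : X -> R) (f : T -> R) : Prop :=
  least_squares_solution mu nu A y f /\
  forall g, least_squares_solution mu nu A y g -> L2norm mu f <= L2norm mu g.

(* Linear regularization in the sense of Engl, Hanke and Neubauer: for every y
   in the domain of the generalized inverse, with generalized solution f, some
   parameter choice rule r satisfies
     sup { |L^(r d yd) yd - f|  :  |yd - y| <= d } -> 0   and
     sup { r d yd               :  |yd - y| <= d } -> 0   as d -> 0.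
   Continuous linear families with L^la y -> f for every such y satisfy this. *)
Definition linear_regularization d1 d2 (T : measurableType d1)
    (X : measurableType d2) (mu : {measure set T -> \bar R})
    (nu : {measure set X -> \bar R}) (A : (T -> R) -> (X -> R))
    (L : R -> (X -> R) -> (T -> R)) : Prop :=
  (forall la, 0 < la -> bounded_linear_L2 nu mu (L la)) /\
  forall y f, y \in Lfun nu 2%:E -> generalized_solution mu nu A y f ->
    exists r : R -> (X -> R) -> R,
      (forall d yd, 0 < d -> 0 < r d yd) /\
      forall e, 0 < e -> \forall d \near 0^'+,
        forall yd, yd \in Lfun nu 2%:E -> L2norm nu (yd \- y) <= d ->
          L2norm mu (L (r d yd) yd \- f) <= e /\ r d yd <= e.

Definition orthonormal_basis d (X : measurableType d)
    (nu : {measure set X -> \bar R}) (B : set (X -> R)) : Prop :=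
  [/\ forall b, B b -> b \in Lfun nu 2%:E,
      forall b, B b -> L2dot nu b b = 1,
      forall b c, B b -> B c -> b <> c -> L2dot nu b c = 0
    & forall z, z \in Lfun nu 2%:E -> forall e, 0 < e ->
        exists (s : seq (X -> R)) (c : (X -> R) -> R),
          (forall b, b \in s -> B b) /\
          L2norm nu (fun x => z x - \sum_(b <- s) c b * b x) < e].

(* The sum of the |L b|^2 over an orthonormal basis does not depend on the
   basis, so any one is selected.  The value is 0 when the sum is infinite. *)
Definition HSnorm d1 d2 (T : measurableType d1) (X : measurableType d2)
    (mu : {measure set T -> \bar R}) (nu : {measure set X -> \bar R})
    (L : (X -> R) -> (T -> R)) : R :=
  Num.sqrt (fine (\esum_(b in get (orthonormal_basis nu))
    (L2norm mu (L b) ^+ 2)%:E)%E).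

End L2.

Section kernel_operator.
Context {R : realType} d1 d2 (T : measurableType d1) (X : measurableType d2).

Definition kernel_operator (nu : {measure set X -> \bar R})
    (l : R -> X -> T -> R) (la : R) (z : X -> R) : T -> R :=
  fun t => \int[nu]_x (l la x t * z x).

(* The last clause is what gives a meaning to the integral over nu of the
   H_1-valued map x |-> l la x * z x. *)
Definition regularization_kernel (mu : {measure set T -> \bar R})
    (nu : {measure set X -> \bar R}) (l : R -> X -> T -> R) : Prop :=
  forall la, 0 < la ->
  [/\ forall x, l la x \in Lfun mu 2%:E,
      forall t, l la ^~ t \in Lfun nu 2%:E,
      exists C : R, forall t, L2norm nu (l la ^~ t) <= C
    & measurable_fun [set: X * T] (fun z => l la z.1 z.2)].

Definition estimator (l : R -> X -> T -> R) (la : R) (n : nat)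
    (w : n.-tuple (X * measurableTypeR R)) : T -> R :=
  fun t => n%:R^-1 * \sum_(i < n) l la (tnth w i).1 t * (tnth w i).2.

(* nu is the marginal of rho, and this states E(g(X,Y) | X = x) = m x for
   nu-almost every x. *)
Definition conditional_expectation
    (rho : {measure set (X * measurableTypeR R) -> \bar R})
    (nu : {measure set X -> \bar R})
    (g : X * measurableTypeR R -> R) (m : X -> R) : Prop :=
  [/\ rho.-integrable setT (EFin \o g), nu.-integrable setT (EFin \o m)
    & forall B, measurable B ->
        (\int[rho]_(z in B `*` setT) (g z)%:E = \int[nu]_(x in B) (m x)%:E)%E].

End kernel_operator.

Section product_power.
Context {R : realType} d (T : measurableType d).

Definition cons_pair (n : nat) (z : T * n.-tuple T) : n.+1.-tuple T :=
  [tuple of z.1 :: z.2].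

Lemma measurable_cons_pair n : measurable_fun [set: T * n.-tuple T] (@cons_pair n).
Proof. exact: measurable_cons measurable_fst measurable_snd. Qed.

HB.instance Definition _ n := isMeasurableFun.Build _ _ _ _ (@cons_pair n)
  (@measurable_cons_pair n).

Fixpoint product_power (rho : probability T R) (n : nat) :
    probability (n.-tuple T) R :=
  match n with
  | 0 => dirac [tuple]
  | m.+1 => distribution (rho \x product_power rho m)%E (@cons_pair m)
  end.

End product_power.

(* Landau's Omega for extended real functions, as the expectation may be
   infinite. *)
Definition is_bigOmega_ereal (R : realType) (I : Type) (F : set_system I)
    (h : I -> \bar R) (k : I -> R) : Prop :=
  exists2 M : R, 0 < M & \forall i \near F, ((M * k i)%:E <= h i)%E.

Section parameter_choice.
Context {R : realType} (sigma : R) (eps : R -> R).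

Definition noise_level (n : nat) (la : R) : R :=
  (Num.sqrt (sigma ^+ 2 / n%:R + eps la ^+ 2) + eps la)^-1
  * (sigma ^+ 2 / n%:R).

Definition sample_size (d la : R) : R :=
  sigma ^+ 2 / (d ^+ 2 + 2 * d * eps la).

(* With dt n = noise_level n (lan n) and nt d = floor (sample_size d (lad d)),
   the conditions are nt \o dt = id, and lad = lan \o nt on the range of dt.
   Hence lan n = lad (dt n). *)
Definition associated_choice (lad : R -> R) (lan : nat -> R) : Prop :=
  let dt n := noise_level n (lan n) in
  let nt d := Num.truncn (sample_size d (lad d)) in
  (forall n, (0 < n)%N -> nt (dt n) = n) /\
  (forall n, (0 < n)%N -> lad (dt n) = lan (nt (dt n))).

End parameter_choice.

(* Main.v *)
Require Import Defs.
From HB Require Import structures.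
From mathcomp Require Import all_boot all_order all_algebra.
From mathcomp Require Import ring lra.
From mathcomp Require Import all_classical all_reals all_analysis.
From mathcomp Require Import measurable_realfun.

Set Implicit Arguments.
Unset Strict Implicit.
Unset Printing Implicit Defensive.

Import Order.TTheory GRing.Theory Num.Theory.
Import numFieldNormedType.Exports HBNNSimple.

Local Open Scope classical_set_scope.
Local Open Scope ring_scope.

(** Write [H] for the Hilbert-Schmidt norm of [L = L^lambda] and [e] for the
ratio [|L y - f| / H], with [f] the generalized solution.

The estimator is unbiased for [L y], so its risk is the squared bias plus a
variance.  At a point [t] the variance of [l(X, t) Y] is at least the part due
to the noise [Y - y(X)], that is [sigma^2 |l(., t)|^2]; integrating over [t]
gives
<<
    risk_n >= |L y - f|^2 + (sigma^2 / n) H^2 = H^2 (e^2 + sigma^2 / n).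
>>
The noise level [d] associated with [n] is chosen so that
[d^2 + 2 d e = sigma^2 / n]; the right-hand side is then [H^2 (e + d)^2].  The
operator norm of [L] being at most [H], this dominates [|L z - f|^2] for every
[z] at distance at most [d] from [y].  Hence every lower bound
[|L y^d - f|^2 >= M d^alpha] passes to the risk ([estimator_risk_ge],
[estimator_risk_ge_deterministic]).

It remains to express [d] through [n].  As [e] is of order [d^(p gamma)], the
equation reads [sigma^2 / n ~ d^2 + d^(1 + p gamma)]; its dominant term is
[d^2] when [p gamma >= 1] and [d^(1 + p gamma)] otherwise, so that
[d ~ n^(-1/r)] with [r = 2] or [r = 1 + p gamma] ([noise_power_bounds],
[associated_choice_rates]).

Three points need care.  The measure [mu] need not be sigma-finite, so that the
squared error need not be a measurable function of the sample and Tonelli's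
theorem is not available on the whole space; a lower bound suffices and is
proved on sets of finite measure ([integral_pointwise_risk_le]).  The product
[l(X, t) Y] need not be square integrable, so the variance is bounded below by
truncation ([single_observation_sqr_risk_ge]).  The Hilbert-Schmidt norm is
defined by a choice of an orthonormal basis and vanishes when there is no basis
or when the sum is infinite; both are excluded because [e] is positive for
small [lambda] ([HSnorm_gt0P]). *)

(** * Inner products and orthonormal families in L^2 *)

Section square_integrable.
Context {R : realType} d (T : measurableType d).
Variable m : {measure set T -> \bar R}.
Implicit Types (f g h : T -> R) (a : R).
Local Notation L2 := (Lfun m 2%:E).

Lemma Lfun_measurable f : f \in L2 -> measurable_fun setT f.
Proof. by rewrite inE => /andP[+ _]; rewrite inE. Qed.

Lemma L2norm_ge0 f : 0 <= L2norm m f.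
Proof. by rewrite /L2norm fine_ge0// Lnorm_ge0. Qed.

Lemma L2norm_EFin f : f \in L2 ->
  ((L2norm m f)%:E = 'N[m]_2%:E[EFin \o f])%E.
Proof.
rewrite inE => /andP[_]; rewrite inE/= => ff.
by rewrite /L2norm fineK// ge0_fin_numE// Lnorm_ge0.
Qed.

Lemma L2norm_sqr f : f \in L2 ->
  ((L2norm m f ^+ 2)%:E = \int[m]_x (f x ^+ 2)%:E)%E.
Proof.
move=> f2; have n2 : (2 : R) != 0 by rewrite pnatr_eq0.
have := powR_Lnorm m (EFin \o f) n2.
rewrite -L2norm_EFin// poweR_EFin powR_mulrn ?L2norm_ge0// => ->.
by apply: eq_integral => x _ /=; rewrite powR_mulrn// real_normK ?num_real.
Qed.

Lemma sum_sqr_integral (I : eqType) (s : seq I) (F : I -> T -> R) :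
  (forall i, i \in s -> F i \in L2) ->
  m.-integrable setT (EFin \o (fun x => \sum_(i <- s) F i x ^+ 2)) /\
  (\int[m]_x (\sum_(i <- s) F i x ^+ 2)%:E = (\sum_(i <- s) L2norm m (F i) ^+ 2)%:E)%E.
Proof.
elim: s => [_|i s ih s2].
  rewrite big_nil (_ : (fun x => _) = cst 0).
    by split; [exact: integrable0|apply: integral0_eq => x _]; rewrite ?big_nil.
  by apply/funext => x; rewrite big_nil.
have [si Is] := ih (fun j js => s2 j (mem_behead (js : j \in behead (i :: s)))).
have i2 := s2 i (mem_head _ _); have ii := Lfun2_integrable_sqr i2.
have sE x : \sum_(j <- i :: s) F j x ^+ 2 = F i x ^+ 2 + \sum_(j <- s) F j x ^+ 2.
  by rewrite big_cons.
rewrite (eq_fun sE) big_cons; split; first exact: (integrableD measurableT ii si).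
under eq_integral do rewrite sE.
by rewrite (integralD_EFin measurableT ii si) Is EFinD L2norm_sqr.
Qed.

Lemma L2norm_integral_sqr f : f \in L2 -> L2norm m f ^+ 2 = L2dot m f f.
Proof. by move=> /L2norm_sqr fE; apply: EFin_inj; rewrite fE /L2dot fineK// -fE. Qed.

Lemma LfunZD a f g : f \in L2 -> g \in L2 -> (fun x => a * f x + g x) \in L2.
Proof.
move=> f2 g2; have -> : (fun x => a * f x + g x) = a *: f + g by [].
by have [_ h] := Lfun_submod_closed m (lee1n 2); exact: h.
Qed.

Lemma Lfun_zero : (fun _ => 0) \in L2.
Proof. by have [h _] := Lfun_submod_closed m (lee1n 2). Qed.

Lemma LfunZ a f : f \in L2 -> (fun x => a * f x) \in L2.
Proof.
move=> f2; rewrite (_ : (fun x => _) = fun x => a * f x + 0); last first.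
  by apply/funext => x; rewrite addr0.
exact: LfunZD f2 Lfun_zero.
Qed.

Lemma LfunD f g : f \in L2 -> g \in L2 -> (f \+ g) \in L2.
Proof.
move=> f2 g2; rewrite (_ : f \+ g = fun x => 1 * f x + g x); first exact: LfunZD.
by apply/funext => x /=; rewrite mul1r.
Qed.

Lemma LfunB f g : f \in L2 -> g \in L2 -> (f \- g) \in L2.
Proof.
move=> f2 g2; rewrite (_ : f \- g = fun x => -1 * g x + f x); first exact: LfunZD.
by apply/funext => x /=; rewrite mulN1r addrC.
Qed.

Lemma L2norm_zero : L2norm m (fun _ => 0) = 0.
Proof. by rewrite /L2norm (Lnorm0 m (p := 2%:E))// eqe pnatr_eq0. Qed.

Lemma L2normZ a f : f \in L2 -> L2norm m (fun x => a * f x) = `|a| * L2norm m f.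
Proof.
move=> f2; apply/eqP; rewrite -(eqrXn2 (n := 2))// ?mulr_ge0 ?L2norm_ge0//.
rewrite exprMn real_normK ?num_real// !L2norm_integral_sqr ?LfunZ// /L2dot -RintegralZl//.
  by apply/eqP; apply: eq_Rintegral => x _; ring.
exact/Lfun1_integrable/(Lfun2_mul_Lfun1 f2 f2).
Qed.

Lemma ler_L2normD f g : f \in L2 -> g \in L2 ->
  L2norm m (f \+ g) <= L2norm m f + L2norm m g.
Proof.
move=> f2 g2; rewrite -lee_fin EFinD !L2norm_EFin ?LfunD//.
by apply: minkowski_EFin; [exact: Lfun_measurable..|rewrite ler1n].
Qed.

Lemma ler_L2normB f g : f \in L2 -> g \in L2 ->
  L2norm m (f \- g) <= L2norm m f + L2norm m g.
Proof.
move=> f2 g2; have ng2 := LfunZ (-1) g2.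
rewrite (_ : f \- g = f \+ (fun x => -1 * g x)); last by apply/funext => x /=; rewrite mulN1r.
by apply: le_trans (ler_L2normD f2 ng2) _; rewrite L2normZ// normrN normr1 mul1r.
Qed.

Lemma ae_eq_L2norm f g : f \in L2 -> g \in L2 -> f = g %[ae m] ->
  L2norm m f = L2norm m g.
Proof.
move=> f2 g2 fg; apply/eqP; rewrite -(eqrXn2 (n := 2))// ?L2norm_ge0//.
rewrite -(inj_eq (@EFin_inj R)) !L2norm_sqr//; apply/eqP.
apply: ge0_ae_eq_integral => //.
- by apply/measurable_EFinP/measurable_funX/Lfun_measurable.
- by apply/measurable_EFinP/measurable_funX/Lfun_measurable.
- by move=> x _; rewrite lee_fin sqr_ge0.
- by move=> x _; rewrite lee_fin sqr_ge0.
- by apply: filterS fg => x /(_ I) /= -> _.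
Qed.

Lemma L2dot_integrable f g : f \in L2 -> g \in L2 ->
  m.-integrable setT (fun x => (f x * g x)%:E).
Proof. by move=> f2 g2; exact/Lfun1_integrable/(Lfun2_mul_Lfun1 f2 g2). Qed.

Lemma L2dotC f g : L2dot m f g = L2dot m g f.
Proof. by apply: eq_Rintegral => x _; rewrite mulrC. Qed.

Lemma L2dotZDl a f g h : f \in L2 -> g \in L2 -> h \in L2 ->
  L2dot m (fun x => a * f x + g x) h = a * L2dot m f h + L2dot m g h.
Proof.
move=> f2 g2 h2; rewrite /L2dot.
under eq_Rintegral do rewrite mulrDl -mulrA.
rewrite RintegralD ?RintegralZl//; try exact: L2dot_integrable.
exact: (integrableZl measurableT a (L2dot_integrable f2 h2)).
Qed.

Lemma L2norm_sqrZD a f g : f \in L2 -> g \in L2 ->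
  L2norm m (fun x => a * f x + g x) ^+ 2 =
  a ^+ 2 * L2norm m f ^+ 2 + 2 * a * L2dot m f g + L2norm m g ^+ 2.
Proof.
move=> f2 g2; have fg2 := LfunZD a f2 g2.
rewrite !L2norm_integral_sqr// L2dotZDl// (L2dotC f) (L2dotC g) !L2dotZDl//.
by rewrite (L2dotC g f); ring.
Qed.

Lemma Lfun_linear_combination (I : eqType) (s : seq I) (c : I -> R) (F : I -> T -> R) :
  (forall i, i \in s -> F i \in L2) -> (fun x => \sum_(i <- s) c i * F i x) \in L2.
Proof.
elim: s => [|i s ih] s2.
  by rewrite (_ : (fun x => _) = fun=> 0) ?Lfun_zero//; apply/funext => x; rewrite big_nil.
rewrite (_ : (fun x => _) = fun x => c i * F i x + \sum_(j <- s) c j * F j x); last first.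
  by apply/funext => x; rewrite big_cons.
apply: LfunZD; first by apply: s2; rewrite mem_head.
by apply: ih => e es; apply: s2; rewrite in_cons es orbT.
Qed.

Section orthonormal_family.
Variable B : set (T -> R).
Hypothesis B2 : forall b, B b -> b \in L2.
Hypothesis B1 : forall b, B b -> L2dot m b b = 1.
Hypothesis Bo : forall b c, B b -> B c -> b <> c -> L2dot m b c = 0.

(** Bessel's inequality and Pythagoras' theorem are the cases where the [c b] are
the Fourier coefficients of [h] and where [h = 0]. *)
Lemma L2norm_sqr_distance_span h (s : seq (T -> R)) (c : (T -> R) -> R) :
  h \in L2 -> uniq s -> (forall b, b \in s -> B b) ->
  L2norm m (fun x => h x - \sum_(b <- s) c b * b x) ^+ 2 =
  L2norm m h ^+ 2 - 2 * \sum_(b <- s) c b * L2dot m h b + \sum_(b <- s) c b ^+ 2.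
Proof.
elim: s h => [|b s ih] h h2 /=.
  move=> _ _; rewrite !big_nil mulr0 subr0 addr0; congr (L2norm _ _ ^+ 2).
  by apply/funext => x; rewrite big_nil subr0.
move=> /andP[bs us] sB.
have Bb : B b by apply: sB; rewrite mem_head.
have sB' b' : b' \in s -> B b' by move=> b's; apply: sB; rewrite in_cons b's orbT.
have hb2 : (fun x => - c b * b x + h x) \in L2 by apply: LfunZD => //; exact: B2.
rewrite !big_cons (_ : (fun x => _) =
    fun x => (- c b * b x + h x) - \sum_(i <- s) c i * i x); last first.
  by apply/funext => x; rewrite big_cons; ring.
rewrite ih// (L2norm_sqrZD (- c b) (B2 Bb) h2) (L2norm_integral_sqr (B2 Bb)) B1//.
rewrite [\sum_(i <- s) c i * _](_ : _ = \sum_(i <- s) c i * L2dot m h i).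
  by rewrite L2dotC; ring.
apply: eq_big_seq => i si; have Bi := sB' _ si.
rewrite (L2dotZDl (- c b) (B2 Bb) h2 (B2 Bi)) (Bo Bb Bi) ?mulr0 ?add0r//.
by move=> bi; move: bs; rewrite bi si.
Qed.

Lemma Bessel_inequality h (s : seq (T -> R)) :
  h \in L2 -> uniq s -> (forall b, b \in s -> B b) ->
  \sum_(b <- s) L2dot m h b ^+ 2 <= L2norm m h ^+ 2.
Proof.
move=> h2 us sB; have := sqr_ge0 (L2norm m (fun x => h x - \sum_(b <- s) L2dot m h b * b x)).
rewrite L2norm_sqr_distance_span//; under eq_bigr do rewrite -expr2.
lra.
Qed.

Lemma Pythagoras (s : seq (T -> R)) (c : (T -> R) -> R) :
  uniq s -> (forall b, b \in s -> B b) ->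
  L2norm m (fun x => \sum_(b <- s) c b * b x) ^+ 2 = \sum_(b <- s) c b ^+ 2.
Proof.
move=> us sB; have := L2norm_sqr_distance_span (fun b => - c b) Lfun_zero us sB.
rewrite L2norm_zero [X in 2 * X]big1_seq; last first.
  move=> b /andP[_ bs]; rewrite [L2dot _ _ _](_ : _ = 0) ?mulr0//.
  by rewrite /L2dot; under eq_Rintegral do rewrite mul0r; rewrite Rintegral_cst// mul0r.
under eq_bigr do rewrite sqrrN.
rewrite expr0n mulr0 subr0 add0r => <-; congr (L2norm _ _ ^+ 2); apply/funext => x.
by rewrite sub0r -sumrN; apply: eq_bigr => b _; rewrite mulNr opprK.
Qed.

End orthonormal_family.
End square_integrable.

(** * The Hilbert-Schmidt norm bounds the operator norm *)

Lemma Cauchy_Schwarz_seq {R : realDomainType} (I : Type) (s : seq I) (a b : I -> R) :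
  (\sum_(i <- s) a i * b i) ^+ 2 <=
  (\sum_(i <- s) a i ^+ 2) * (\sum_(i <- s) b i ^+ 2).
Proof.
elim: s => [|i s ih]; first by rewrite !big_nil expr0n mul0r.
rewrite !big_cons; move: ih.
set u := \sum_(j <- s) _; set P := \sum_(j <- s) _ ^+ 2; set Q := \sum_(j <- s) _ ^+ 2.
move=> uPQ.
have P0 : 0 <= P by apply: sumr_ge0 => j _; exact: sqr_ge0.
have Q0 : 0 <= Q by apply: sumr_ge0 => j _; exact: sqr_ge0.
suff : 2 * (a i * b i * u) <= P * b i ^+ 2 + Q * a i ^+ 2 by nra.
apply: le_trans (ler_norm _) _.
have R0 : 0 <= P * b i ^+ 2 + Q * a i ^+ 2.
  by rewrite addr_ge0// mulr_ge0// sqr_ge0.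
rewrite -(ler_pXn2r (n := 2))// ?nnegrE// real_normK ?num_real//.
have := ler_wpM2l (sqr_ge0 (a i * b i)) uPQ.
have := sqr_ge0 (P * b i ^+ 2 - Q * a i ^+ 2).
nra.
Qed.

Section operator_norm.
Context {R : realType} d1 d2 (T : measurableType d1) (X : measurableType d2).
Variables (mu : {measure set T -> \bar R}) (nu : {measure set X -> \bar R}).
Variable L : (X -> R) -> (T -> R).
Hypothesis hL : bounded_linear_L2 nu mu L.
Local Notation L2 := (Lfun nu 2%:E).

Let L_Lfun f : f \in L2 -> L f \in Lfun mu 2%:E.
Proof. by case: hL => + _ _; apply. Qed.

Lemma L2norm_linear_le a f g : f \in L2 -> g \in L2 ->
  L2norm mu (L (fun x => a * f x + g x)) <= `|a| * L2norm mu (L f) + L2norm mu (L g).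
Proof.
move=> f2 g2; case: hL => _ lin _.
rewrite (ae_eq_L2norm _ _ (lin a _ _ f2 g2)) ?LfunZD ?L_Lfun ?LfunZD//.
rewrite -L2normZ ?L_Lfun//; apply: ler_L2normD; last exact: L_Lfun.
by apply: LfunZ; exact: L_Lfun.
Qed.

Lemma L2norm_linear_span_le (s : seq (X -> R)) (c : (X -> R) -> R) :
  (forall b, b \in s -> b \in L2) ->
  L2norm mu (L (fun x => \sum_(b <- s) c b * b x)) <=
  \sum_(b <- s) `|c b| * L2norm mu (L b).
Proof.
elim: s => [|b s ih] s2.
  rewrite big_nil (_ : (fun x => _) = fun=> 0); last first.
    by apply/funext => x; rewrite big_nil.
  case: hL => _ _ [C /(_ _ (Lfun_zero nu))].
  by rewrite L2norm_zero mulr0.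
have s2' b' : b' \in s -> b' \in L2 by move=> b's; apply: s2; rewrite in_cons b's orbT.
rewrite (_ : (fun x => _) = fun x => c b * b x + \sum_(i <- s) c i * i x); last first.
  by apply/funext => x; rewrite big_cons.
rewrite big_cons; apply: le_trans (lerD (lexx _) (ih s2')).
by apply: L2norm_linear_le; [apply: s2; rewrite mem_head|exact: Lfun_linear_combination].
Qed.

Section orthonormal_basis.
Variable B : set (X -> R).
Hypothesis hB : orthonormal_basis nu B.

Let B2 b : B b -> b \in L2. Proof. by case: hB => + _ _ _; apply. Qed.

(** The approximating sequences provided by a basis may repeat a vector; the
repetitions are gathered into the coefficients. *)
Lemma dense_uniq_span z e : z \in L2 -> 0 < e ->
  exists (s : seq (X -> R)) (c : (X -> R) -> R),
    [/\ uniq s, (forall b, b \in s -> B b)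
      & L2norm nu (fun x => z x - \sum_(b <- s) c b * b x) < e].
Proof.
move=> z2 e0; case: hB => _ _ _ /(_ z z2 e e0)[s [c [sB se]]].
exists (undup s), (fun b => c b *+ count_mem b s); split; first exact: undup_uniq.
  by move=> b; rewrite mem_undup; exact: sB.
move: se; congr (L2norm _ _ < _); apply/funext => x; congr (_ - _).
rewrite -big_undup_iterop_count; apply: eq_bigr => b _.
by rewrite mulrnAl; case: (count_mem b s) => //= n; rewrite iteropS; elim: n => //= n <-.
Qed.

(** For a finite combination of basis vectors this is the inequality of Cauchy and
Schwarz together with Pythagoras' theorem; density and the boundedness of [L] do
the rest. *)
Lemma L2norm_operator_le (S : R) z :
  (forall s, uniq s -> (forall b, b \in s -> B b) ->
    \sum_(b <- s) L2norm mu (L b) ^+ 2 <= S) ->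
  z \in L2 -> L2norm mu (L z) <= Num.sqrt S * L2norm nu z.
Proof.
move=> LS z2; case: hL => _ _ [C LC]; have [_ B1 Bo _] := hB.
have S0 : 0 <= S by have := LS [::]; rewrite big_nil; exact.
apply/ler_addgt0Pl => e e0.
(* chosen so that the total approximation error below is at most [e] *)
pose e' := e / (Num.sqrt S + `|C| + 1).
have D0 : 0 < Num.sqrt S + `|C| + 1 by rewrite ltr_wpDl// addr_ge0// sqrtr_ge0.
have e'0 : 0 < e' by rewrite divr_gt0.
have [s [c [us sB]]] := dense_uniq_span z2 e'0.
set w := fun x => \sum_(b <- s) c b * b x.
set r := fun x => _ => re'.
have w2 : w \in L2 by apply: Lfun_linear_combination => b /sB /B2.
have r2 : r \in L2 by exact: LfunB.
have zE : z = fun x => 1 * w x + r x by apply/funext => x; rewrite /r /w; ring.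
have Lw : L2norm mu (L w) <= Num.sqrt S * L2norm nu w.
  apply: (le_trans (L2norm_linear_span_le _ _)); first by move=> b /sB /B2.
  rewrite -(ler_pXn2r (n := 2))// ?nnegrE ?mulr_ge0 ?sqrtr_ge0 ?L2norm_ge0//; last first.
    by apply: sumr_ge0 => b _; rewrite mulr_ge0 ?L2norm_ge0.
  rewrite exprMn sqr_sqrtr// (Pythagoras B2 B1 Bo)//.
  apply: le_trans (Cauchy_Schwarz_seq _ _ _) _; rewrite mulrC.
  under [X in _ * X <= _]eq_bigr do rewrite real_normK ?num_real//.
  by apply: ler_wpM2r; [apply: sumr_ge0 => b _; exact: sqr_ge0|exact: LS].
have wz : L2norm nu w <= L2norm nu z + e'.
  have -> : w = z \- r by apply/funext => x; rewrite /r /w /=; ring.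
  by apply: le_trans (ler_L2normB z2 r2) _; rewrite lerD2l ltW.
have Lr : L2norm mu (L r) <= `|C| * e'.
  apply: le_trans (LC _ r2) _; apply: le_trans (_ : `|C| * L2norm nu r <= _).
    by apply: ler_wpM2r; [exact: L2norm_ge0|exact: ler_norm].
  by apply: ler_wpM2l => //; exact: ltW.
have := L2norm_linear_le 1 w2 r2; rewrite -zE normr1 mul1r => /le_trans; apply.
apply: le_trans (lerD Lw Lr) _.
apply: le_trans (lerD (ler_wpM2l (sqrtr_ge0 S) wz) (lexx _)) _.
have eE : (Num.sqrt S + `|C| + 1) * e' = e by rewrite /e' mulrC divfK// gt_eqF.
rewrite -[X in _ <= X + _]eE; nra.
Qed.

End orthonormal_basis.

(** When the Hilbert-Schmidt norm is not zero, there is an orthonormal basis (the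
default set is empty) and the sum of squares is finite (an infinite sum is sent
to zero), so that the square of the norm is a genuine supremum of finite sums. *)
Lemma HSnorm_gt0P : 0 < HSnorm mu nu L ->
  exists B : set (X -> R), [/\ orthonormal_basis nu B,
    (forall s, uniq s -> (forall b, b \in s -> B b) ->
      \sum_(b <- s) L2norm mu (L b) ^+ 2 <= HSnorm mu nu L ^+ 2)
  & forall r, (forall s, uniq s -> (forall b, b \in s -> B b) ->
      \sum_(b <- s) L2norm mu (L b) ^+ 2 <= r) -> HSnorm mu nu L ^+ 2 <= r].
Proof.
rewrite /HSnorm sqrtr_gt0; set B := get _; set S := esum _ _ => S0.
have hB : orthonormal_basis nu B.
  apply: getPex; apply/not_existsP => noB; move: S0.
  by rewrite /S /B (getPN noB) esum_set0/= ltxx.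
have SE : S = (fine S)%:E by move: S0; case: S => //=; rewrite ltxx.
exists B; split=> //.
- move=> s us sB; rewrite sqr_sqrtr ?(ltW S0)// -lee_fin -SE.
  rewrite /S /esum; apply: ereal_sup_ubound; exists [set` s] => /=.
    by rewrite /fsets /=; split; [exact: finite_seq|exact: sB].
  by rewrite -fsbig_seq// sumEFin.
- move=> r rS; rewrite sqr_sqrtr ?(ltW S0)// -lee_fin -SE.
  rewrite /S /esum; apply: ge_ereal_sup => _ [F [Ff FB] <-].
  rewrite fsbig_finite//= sumEFin lee_fin; apply: rS; first exact: finmap.fset_uniq.
  by move=> b; rewrite in_fset_set// inE; exact: FB.
Qed.

Lemma L2norm_operator_HSnorm z : 0 < HSnorm mu nu L -> z \in L2 ->
  L2norm mu (L z) <= HSnorm mu nu L * L2norm nu z.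
Proof.
move=> H0 z2; have [B [hB BH _]] := HSnorm_gt0P H0.
by have := L2norm_operator_le hB BH z2; rewrite sqrtr_sqr ger0_norm// ltW.
Qed.
End operator_norm.

(** * The regression model: one observation *)

Lemma integral_probability_cst {R : realType} d (T : measurableType d)
  (P : probability T R) (r : R) : (\int[P]_x r%:E = r%:E)%E.
Proof. by have := expectation_cst P r; rewrite unlock. Qed.

Section weighted_integrals.
Local Open Scope ereal_scope.
Context {R : realType} dO dX (O : measurableType dO) (X : measurableType dX).
Variables (m : {measure set O -> \bar R}) (phi : O -> X) (k : O -> R).
Hypothesis mphi : measurable_fun setT phi.
Hypothesis mk : measurable_fun setT k.
Hypothesis k0 : forall z, (0 <= k z)%R.



Lemma weighted_integral_nnsfun (h : {nnsfun X >-> R}) :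
  \int[m]_z (h (phi z) * k z)%:E =
  sintegral (fun B => \int[m]_(z in phi @^-1` B) (k z)%:E) h.
Proof.
rewrite sintegralET.
under eq_integral => z _.
  rewrite EFinM fimfunE -fsumEFin// ge0_mule_fsuml; last first.
    by move=> y; rewrite lee_fin; exact: nnfun_muleindic_ge0.
  over.
rewrite ge0_integral_fsum//; last 2 first.
- move=> y; apply: emeasurable_funM; apply/measurable_EFinP => //.
  apply: measurable_funM => //; apply: (measurableT_comp _ mphi).
  exact: measurable_indic.
- by move=> y z _; rewrite mule_ge0 ?lee_fin//; exact: nnfun_muleindic_ge0.
rewrite (fsbig_widen (range h) setT)//=; last first.
  move=> y [_ Ny] /=; rewrite integral0_eq// => z _.
  by rewrite preimage10// indicE in_set0 mulr0 mul0e.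
apply: eq_fsbigr => y _.
have [y0|y0] := ltP y 0%R.
  rewrite (_ : h @^-1` [set y] = set0) ?preimage_set0 ?integral_set0 ?mule0; last first.
    by rewrite -subset0 => x /= hxy; have : (0 <= h x)%R by []; rewrite hxy leNgt y0.
  by rewrite integral0_eq// => z _; rewrite indicE in_set0 mulr0 mul0e.
rewrite [in RHS]integral_mkcond -ge0_integralZl_EFin//; last 2 first.
- by move=> z _; apply: erestrict_ge0 => x _; rewrite lee_fin.
- apply/(measurable_restrictT _ _).1; last exact/measurable_funTS/measurable_EFinP.
  by rewrite -[X in measurable X]setTI; exact: mphi.
apply: eq_integral => z _; rewrite epatch_indic EFinM -muleA; congr (_ * _).
by rewrite muleC.
Qed.

Lemma weighted_integral_lim (g : X -> R) :
  forall mg : measurable_fun setT (EFin \o g), (forall x, 0 <= g x)%R ->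
  \int[m]_z (g (phi z) * k z)%:E = limn (fun n =>
    sintegral (fun B => \int[m]_(z in phi @^-1` B) (k z)%:E) (nnsfun_approx measurableT mg n)).
Proof.
move=> mg g0; pose h := nnsfun_approx measurableT mg.
under [in RHS]eq_fun do rewrite -weighted_integral_nnsfun.
rewrite -monotone_convergence//.
- apply: eq_integral => z _; apply/esym/cvg_lim => //.
  rewrite EFinM; under eq_fun do rewrite EFinM.
  by apply: cvgeZr => //; apply: cvg_nnsfun_approx => // x _; rewrite lee_fin.
- move=> n; apply/measurable_EFinP/measurable_funM => //.
  exact: measurableT_comp.
- by move=> n z _; rewrite lee_fin mulr_ge0.
- move=> z _ a b ab; rewrite lee_fin; apply: ler_wpM2r => //.
  exact/lefP/nd_nnsfun_approx.
Qed.

End weighted_integrals.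

(** The integral of a simple function only involves the weighted masses of its
level sets, which are the same on both sides; monotone convergence does the
rest. *)
Lemma eq_weighted_integral {R : realType} d1 d2 dX (O1 : measurableType d1)
    (O2 : measurableType d2) (X : measurableType dX)
    (m1 : {measure set O1 -> \bar R}) (m2 : {measure set O2 -> \bar R})
    (phi1 : O1 -> X) (phi2 : O2 -> X) (k1 : O1 -> R) (k2 : O2 -> R) (g : X -> R) :
  measurable_fun setT phi1 -> measurable_fun setT phi2 ->
  measurable_fun setT k1 -> measurable_fun setT k2 ->
  (forall z, 0 <= k1 z) -> (forall z, 0 <= k2 z) ->
  measurable_fun setT g -> (forall x, 0 <= g x) ->
  (forall B, measurable B ->
    (\int[m1]_(z in phi1 @^-1` B) (k1 z)%:E = \int[m2]_(z in phi2 @^-1` B) (k2 z)%:E)%E) ->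
  (\int[m1]_z (g (phi1 z) * k1 z)%:E = \int[m2]_z (g (phi2 z) * k2 z)%:E)%E.
Proof.
move=> mphi1 mphi2 mk1 mk2 k10 k20 mg g0 k12.
have mg' : measurable_fun setT (EFin \o g) by exact/measurable_EFinP.
rewrite (weighted_integral_lim _ mphi1 mk1 k10 mg' g0).
rewrite (weighted_integral_lim _ mphi2 mk2 k20 mg' g0).
congr (limn _); apply/funext => n; rewrite !sintegralET; apply: eq_fsbigr => y _.
by rewrite k12//; exact: measurable_funPTI.
Qed.

Section regression_model.
Context {R : realType} d (X : measurableType d).
Variables (rho : probability (X * measurableTypeR R)%type R) (nu : probability X R).
Hypothesis nuE : forall B, measurable B -> nu B = rho (B `*` setT).
Variables (y : X -> R) (sigma : R).
Hypothesis y2 : y \in Lfun nu 2%:E.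
Hypothesis hmean : conditional_expectation rho nu (fun z => z.2) y.
Hypothesis hvar : conditional_expectation rho nu
  (fun z => (z.2 - y z.1) ^+ 2) (cst (sigma ^+ 2)).
Let Z := (X * measurableTypeR R)%type.
Let D (z : Z) : R := z.2 - y z.1.

Let my : measurable_fun setT y. Proof. exact: Lfun_measurable y2. Qed.

Let mD : measurable_fun setT D.
Proof.
apply: measurable_funB; first exact: measurable_snd.
exact: measurableT_comp my measurable_fst.
Qed.

Let mpreim B : measurable B -> measurable (fst @^-1` B : set Z).
Proof. by move=> mB; rewrite -[X in measurable X]setTI; exact: measurable_fst. Qed.

Lemma marginal_pushforward B : measurable B -> nu B = pushforward rho fst B.
Proof. by move=> mB; rewrite nuE// setXT. Qed.

Lemma ge0_integral_marginal (g : X -> R) :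
  measurable_fun setT g -> (forall x, 0 <= g x) ->
  (\int[rho]_z (g z.1)%:E = \int[nu]_x (g x)%:E)%E.
Proof.
move=> mg g0; rewrite (eq_measure_integral (pushforward rho fst)); last first.
  by move=> B mB _; exact: marginal_pushforward.
rewrite ge0_integral_pushforward//; first exact/measurable_EFinP.
by move=> x _; rewrite lee_fin.
Qed.

Let integrable_y : rho.-integrable setT (fun z : Z => (y z.1)%:E).
Proof.
case: hmean => _ /integrableP[_ yoo] _; apply/integrableP; split.
  apply/measurable_EFinP; exact: measurableT_comp my measurable_fst.
move: yoo; congr (_ < +oo)%E; apply/esym.
by apply: (ge0_integral_marginal (g := fun x => `|y x|)) => //; exact: measurableT_comp.
Qed.

Let integrable_D : rho.-integrable setT (EFin \o D).
Proof. by case: hmean => Yi _ _; exact: (integrableB measurableT Yi integrable_y). Qed.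

Let integral_y B : measurable B ->
  (\int[rho]_(z in fst @^-1` B) (y z.1)%:E = \int[nu]_(x in B) (y x)%:E)%E.
Proof.
move=> mB; rewrite [RHS](eq_measure_integral (pushforward rho fst)); last first.
  by move=> A mA _; exact: marginal_pushforward.
rewrite integral_pushforward//; first exact/measurable_EFinP.
by apply: integrableS integrable_y => //; exact: mpreim.
Qed.

Let integral_D B : measurable B -> (\int[rho]_(z in fst @^-1` B) (D z)%:E = 0)%E.
Proof.
move=> mB; case: hmean => Yi yi YE.
have mB' := mpreim mB.
have Yi' := integrableS measurableT mB' (@subsetT _ _) Yi.
have yi' := integrableS measurableT mB' (@subsetT _ _) integrable_y.
rewrite (integralB_EFin mB' Yi' yi') integral_y// -setXT YE//.
apply: subee; apply: integrable_fin_num => //.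
by apply: integrableS yi.
Qed.
Let mDp : measurable_fun setT (D^\+). Proof. exact: measurable_funrpos. Qed.
Let mDn : measurable_fun setT (D^\-). Proof. exact: measurable_funrneg. Qed.

Let integral_Dpos_Dneg B : measurable B ->
  (\int[rho]_(z in fst @^-1` B) (D^\+ z)%:E = \int[rho]_(z in fst @^-1` B) (D^\- z)%:E)%E.
Proof.
move=> mB; have Di := integrableS measurableT (mpreim mB) (@subsetT _ _) integrable_D.
have := integral_D mB; rewrite integralE funerpos funerneg => /eqP.
have np := integrable_pos_fin_num (mpreim mB) Di.
have nn := integrable_neg_fin_num (mpreim mB) Di.
rewrite funerpos in np; rewrite funerneg in nn.
by rewrite sube_eq ?fin_num_adde_defl// add0e => /eqP.
Qed.

Let integrable_bounded (g : X -> R) (M : R) (F : Z -> R) : measurable_fun setT g ->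
  (forall x, `|g x| <= M) -> rho.-integrable setT (EFin \o F) ->
  rho.-integrable setT (fun z => (g z.1 * F z)%:E).
Proof.
move=> mg gM Fi; apply: (integrableMr measurableT _ _ Fi (h := g \o fst)).
  exact: measurableT_comp.
by exists M; split; [exact: num_real|move=> a Ma x _ /=; rewrite (le_trans (gM _))// ltW].
Qed.

Let integral_ge0_bounded_D (g : X -> R) (M : R) : measurable_fun setT g ->
  (forall x, 0 <= g x <= M) -> (\int[rho]_z (g z.1 * D z)%:E = 0)%E.
Proof.
move=> mg gM; have g0 x : 0 <= g x by case/andP: (gM x).
have Di : rho.-integrable setT (fun z => (g z.1 * D z)%:E).
  apply: (integrable_bounded (M := M)) => // x.
  by rewrite ger0_norm//; case/andP: (gM x).
have np := integrable_pos_fin_num measurableT Di.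
rewrite integralE.
have gp : (fun z => (g z.1 * D z)%:E)^\+%E = (fun z => (g z.1 * D^\+ z)%:E).
  rewrite (funerpos (fun z => g z.1 * D z)); apply/funext => z.
  by rewrite /= /funrpos maxr_pMr// mulr0.
have gn : (fun z => (g z.1 * D z)%:E)^\-%E = (fun z => (g z.1 * D^\- z)%:E).
  rewrite (funerneg (fun z => g z.1 * D z)); apply/funext => z.
  by rewrite /= /funrneg -mulrN maxr_pMr// mulr0.
rewrite gp in np *; rewrite gn.
rewrite [X in (X - _)%E](eq_weighted_integral (phi2 := fst) (k2 := D^\-) (m2 := rho))//.
rewrite subee// -(eq_weighted_integral (m1 := rho) (phi1 := fst) (k1 := D^\+))//.
Qed.

(** The residual [Y - y(X)] is orthogonal to the bounded functions of [X].  Its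
positive and negative parts give the same mass to every event on [X], which
settles nonnegative functions; adding a constant reduces to these. *)
Lemma integral_bounded_residual (g : X -> R) (M : R) : measurable_fun setT g ->
  (forall x, `|g x| <= M) -> (\int[rho]_z (g z.1 * D z)%:E = 0)%E.
Proof.
move=> mg gM.
have gM' x : 0 <= g x + M <= M + M.
  by have := gM x; rewrite ler_norml => /andP[? ?]; apply/andP; split; lra.
have mgM : measurable_fun setT (fun x => g x + M) by exact: measurable_funD.
have := integral_ge0_bounded_D mgM gM'.
under eq_integral do rewrite mulrDl EFinD.
rewrite integralD//; last 2 first.
- exact: integrable_bounded gM integrable_D.
- exact: (integrableZl measurableT M integrable_D).
under [X in (_ + X)%E]eq_integral do rewrite EFinM.
rewrite (integralZl measurableT integrable_D M).
by have := integral_D measurableT; rewrite preimage_setT => ->; rewrite mule0 adde0.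
Qed.
Let integrable_D2 : rho.-integrable setT (fun z => (D z ^+ 2)%:E).
Proof. by case: hvar. Qed.

Let integral_bounded_D2 (g : X -> R) : measurable_fun setT g ->
  (forall x, 0 <= g x) ->
  (\int[rho]_z (g z.1 * D z ^+ 2)%:E = \int[nu]_x (g x * sigma ^+ 2)%:E)%E.
Proof.
move=> mg g0.
rewrite (eq_weighted_integral (phi2 := id) (k2 := cst (sigma ^+ 2)) (m2 := nu)
  (phi1 := fst) (k1 := fun z : Z => D z ^+ 2))//.
- exact: measurable_funX.
- by move=> z; exact: sqr_ge0.
- by move=> z; exact: sqr_ge0.
- by move=> B mB; case: hvar => _ _ /(_ B mB); rewrite setXT.
Qed.

Section single_observation.
Variables (h : X -> R) (c : R).
Hypothesis h2 : h \in Lfun nu 2%:E.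
Let mh : measurable_fun setT h. Proof. exact: Lfun_measurable h2. Qed.
Let u x := h x * y x - c.
Let meas_u : measurable_fun setT u.
Proof. by apply: measurable_funB => //; exact: measurable_funM. Qed.

Let B_ (k : nat) := (fun x => `|h x| + `|y x|) @^-1` `]-oo, k%:R].

Let mB_ k : measurable (B_ k).
Proof.
have mhy : measurable_fun setT (fun x => `|h x| + `|y x|).
  by apply: measurable_funD; exact: measurableT_comp.
by rewrite -[X in measurable X]setTI; apply: mhy => //; exact: measurable_itv.
Qed.

Let mrest (g : X -> R) k : measurable_fun setT g ->
  measurable_fun setT (fun x => \1_(B_ k) x * g x).
Proof. by move=> mg; apply: measurable_funM => //; exact: measurable_indic. Qed.

Let truncated_sqr_risk_ge k :
  (\int[nu]_(x in B_ k) (sigma ^+ 2 * h x ^+ 2 + u x ^+ 2)%:E <=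
   \int[rho]_z ((h z.1 * z.2 - c) ^+ 2)%:E)%E.
Proof.
pose w x : R := \1_(B_ k) x.
have w0 x : 0 <= w x by rewrite /w indicE.
have wsqr_ge0 (v : R) x : 0 <= w x * v ^+ 2 by rewrite mulr_ge0// sqr_ge0.
have Bk x : B_ k x -> `|h x| <= k%:R /\ `|u x| <= k%:R * k%:R + `|c|.
  rewrite /B_ /= in_itv/= => hyk.
  have hk : `|h x| <= k%:R by apply: le_trans hyk; rewrite lerDl.
  have yk : `|y x| <= k%:R by apply: le_trans hyk; rewrite lerDr.
  split=> //; apply: le_trans (ler_normB _ _) _; rewrite lerD2r normrM.
  exact: ler_pM.
have wM (g : X -> R) M : 0 <= M -> (forall x, B_ k x -> `|g x| <= M) ->
    forall x, `|w x * g x| <= M.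
  move=> M0 gM x; rewrite /w indicE; case: (asboolP (B_ k x)) => Bx.
    by rewrite mem_set// mul1r; exact: gM.
  by rewrite memNset// mul0r normr0.
have K0 : 0 <= k%:R * k%:R + `|c| :> R by rewrite addr_ge0// mulr_ge0.
have i1 : rho.-integrable setT (fun z => (w z.1 * h z.1 ^+ 2 * D z ^+ 2)%:E).
  apply: (integrable_bounded (g := fun x => w x * h x ^+ 2) (M := k%:R ^+ 2)) => //.
    exact/mrest/measurable_funX.
  by apply: wM => [|x /Bk[hk _]]; [exact: sqr_ge0|rewrite normrX lerXn2r ?nnegrE].
have i2 : rho.-integrable setT (fun z => (w z.1 * u z.1 ^+ 2)%:E).
  have := @integrable_bounded (fun x => w x * u x ^+ 2) ((k%:R * k%:R + `|c|) ^+ 2) (cst 1).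
  under [X in _ -> _ -> _ -> _.-integrable _ X]eq_fun do rewrite mulr1.
  apply; first exact/mrest/measurable_funX.
    by apply: wM => [|x /Bk[_ uk]]; [exact: sqr_ge0|rewrite normrX lerXn2r ?nnegrE].
  exact: finite_measure_integrable_cst.
pose g3 x := w x * (2 * h x * u x).
have mg3 : measurable_fun setT g3.
  by apply: mrest; apply: measurable_funM => //; exact: measurable_funM.
have bg3 : forall x, `|g3 x| <= 2 * k%:R * (k%:R * k%:R + `|c|).
  apply: wM => [|x /Bk[hk uk]]; first by rewrite mulr_ge0// mulr_ge0.
  by rewrite !normrM (ger0_norm (ler0n _ 2)) ler_pM ?mulr_ge0// ler_pM.
have i3 := integrable_bounded mg3 bg3 integrable_D.
(* the cross term [g3] is orthogonal to the residual *)
have wE z : (w z.1 * (h z.1 * z.2 - c) ^+ 2)%:E =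
    ((w z.1 * h z.1 ^+ 2 * D z ^+ 2)%:E + (w z.1 * u z.1 ^+ 2)%:E + (g3 z.1 * D z)%:E)%E.
  by rewrite -!EFinD; congr EFin; rewrite /g3 /u /D; ring.
apply: (@le_trans _ _ (\int[rho]_z (w z.1 * (h z.1 * z.2 - c) ^+ 2)%:E)%E); last first.
  have mZ : measurable_fun setT (fun z : Z => (h z.1 * z.2 - c) ^+ 2).
    apply: measurable_funX; apply: measurable_funB => //.
    by apply: measurable_funM; [exact: measurableT_comp mh measurable_fst|exact: measurable_snd].
  apply: ge0_le_integral => //.
  - by move=> z _; rewrite lee_fin mulr_ge0// sqr_ge0.
  - apply/measurable_EFinP/measurable_funM => //.
    by apply: measurableT_comp (measurable_fst); exact: measurable_indic.
  - exact/measurable_EFinP.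
  - move=> z _; rewrite lee_fin ler_piMl ?sqr_ge0// /w indicE.
    by case: (_ \in _).
under [leRHS]eq_integral do rewrite wE.
rewrite integralD//; last exact: integrableD.
rewrite integralD// (integral_bounded_residual mg3 bg3) adde0.
rewrite (integral_bounded_D2 (g := fun x => w x * h x ^+ 2)); last 2 first.
- exact/mrest/measurable_funX.
- by move=> x; exact: wsqr_ge0.
rewrite (ge0_integral_marginal (g := fun x => w x * u x ^+ 2)); last 2 first.
- exact/mrest/measurable_funX.
- by move=> x; exact: wsqr_ge0.
rewrite -ge0_integralD//; last 4 first.
- by move=> x _; rewrite lee_fin mulr_ge0 ?wsqr_ge0 ?sqr_ge0.
- by apply/measurable_EFinP/measurable_funM => //; exact/mrest/measurable_funX.
- by move=> x _; rewrite lee_fin wsqr_ge0.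
- exact/measurable_EFinP/mrest/measurable_funX.
rewrite [leLHS]integral_mkcond le_eqVlt; apply/orP; left; apply/eqP; apply: eq_integral => x _.
by rewrite epatch_indic -EFinM -EFinD; congr EFin; rewrite /w; ring.
Qed.

Let F x := sigma ^+ 2 * h x ^+ 2 + u x ^+ 2.
Let mF : measurable_fun setT F.
Proof.
by apply: measurable_funD; [apply: measurable_funM|]; exact: measurable_funX.
Qed.
Let F0 x : 0 <= F x.
Proof. by apply: addr_ge0; [apply: mulr_ge0|]; exact: sqr_ge0. Qed.

Let sqr_risk_ge :
  (\int[nu]_x (F x)%:E <= \int[rho]_z ((h z.1 * z.2 - c) ^+ 2)%:E)%E.
Proof.
have BT : \bigcup_k B_ k = setT.
  rewrite -subTset => x _; have [k hk] : exists k : nat, `|h x| + `|y x| < k%:R.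
    by exists (Num.bound (`|h x| + `|y x|)); rewrite archi_boundP// addr_ge0.
  by exists k => //; rewrite /B_ /= in_itv/= ltW.
rewrite -BT; apply: (cvge_le _ (ge0_nondecreasing_set_cvg_integral _ _ _ _)) => //.
- by apply: nearW => k; exact: truncated_sqr_risk_ge.
- move=> i j ij; rewrite subsetEset => x; rewrite /B_ /= !in_itv/= => /le_trans; apply.
  by rewrite ler_nat.
- by move=> i; exact/measurable_funTS/measurable_EFinP.
- by move=> i x _; rewrite lee_fin.
Qed.

(** The noise [h(X) (Y - y(X))] is orthogonal to the functions of [X], so that its
variance [sigma^2 |h|^2] adds to the mean square of [h(X) y(X) - c], which is at
least the squared bias.  As [h(X) Y] need not be square integrable, the
computation is done on the sets where [h] and [y] are bounded, which exhaust the
space. *)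
Lemma single_observation_sqr_risk_ge :
  (((L2dot nu h y - c) ^+ 2 + sigma ^+ 2 * L2norm nu h ^+ 2)%:E <=
   \int[rho]_z ((h z.1 * z.2 - c) ^+ 2)%:E)%E.
Proof.
apply: le_trans sqr_risk_ge.
have [->|Foo] := eqVneq (\int[nu]_x (F x)%:E)%E +oo%E; first exact: leey.
have iF : nu.-integrable setT (EFin \o F).
  apply/integrableP; split; first exact/measurable_EFinP.
  under eq_integral do rewrite /= ger0_norm//.
  by rewrite lt_neqAle Foo leey.
pose b := L2dot nu h y - c.
(* tangent to the square at the mean *)
pose G x := sigma ^+ 2 * (h x * h x) + (2 * b * (h x * y x) - (2 * b * c + b ^+ 2)).
have ihh := L2dot_integrable h2 h2; have ihy := L2dot_integrable h2 y2.
have i1 := integrableZl measurableT (sigma ^+ 2) ihh.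
have i2 := integrableZl measurableT (2 * b) ihy.
have i3 := finite_measure_integrable_cst nu (2 * b * c + b ^+ 2) measurableT.
have i23 := integrableB measurableT i2 i3.
have iG : nu.-integrable setT (EFin \o G) := integrableD measurableT i1 i23.
apply: (@le_trans _ _ (\int[nu]_x (G x)%:E)%E); last first.
  apply: le_integral => // x _; rewrite lee_fin /G /F /u.
  have := sqr_ge0 (h x * y x - c - b); nra.
rewrite (integralD measurableT i1 i23) (integralB measurableT i2 i3).
have e3 := integral_probability_cst nu (2 * b * c + b ^+ 2).
have e1 : (\int[nu]_x (h x * h x)%:E = (L2norm nu h ^+ 2)%:E)%E.
  by rewrite L2norm_integral_sqr// /L2dot fineK// integrable_fin_num.
have e2 : (\int[nu]_x (h x * y x)%:E = (L2dot nu h y)%:E)%E.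
  by rewrite /L2dot fineK// integrable_fin_num.
rewrite [X in (_ - X)%E]e3 !integralZl// e1 e2 -!EFinM -EFinB -EFinD lee_fin /b; nra.
Qed.
End single_observation.
End regression_model.

(** * Sums of independent observations *)

Section product_power.
Context {R : realType} d (T : measurableType d) (rho : probability T R).
Local Open Scope ereal_scope.

Lemma ge0_integral_product_powerS n (f : n.+1.-tuple T -> \bar R) :
  measurable_fun setT f -> (forall w, 0 <= f w) ->
  \int[product_power rho n.+1]_w f w =
  \int[rho]_z \int[product_power rho n]_w f (cons_pair (z, w)).
Proof.
move=> mf f0; rewrite ge0_integral_distribution// fubini_tonelli1//.
- exact: measurableT_comp.
- by move=> x; exact: f0.
Qed.

Lemma measurable_tuple_sum (f : T -> R) n : measurable_fun setT f ->
  measurable_fun setT (fun w : n.-tuple T => \sum_(i < n) f (tnth w i))%R.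
Proof.
move=> mf; apply: measurable_sum => i; apply: measurableT_comp mf _.
exact: measurable_tnth.
Qed.

(** Quantifying over all centers [c] makes the bound additive: the
contribution of the first draw is absorbed into the center of the others. *)
Lemma product_power_sqr_risk_ge (f : T -> R) (a v : R) :
  measurable_fun setT f -> (0 <= v)%R ->
  (forall c, ((a - c) ^+ 2 + v)%:E <= \int[rho]_z ((f z - c) ^+ 2)%:E) ->
  forall n c, ((n%:R * a - c) ^+ 2 + n%:R * v)%:E <=
    \int[product_power rho n]_w ((\sum_(i < n) f (tnth w i) - c) ^+ 2)%:E.
Proof.
move=> mf v0 fv; elim=> [|n ih] c.
  rewrite /= integral_dirac//.
    by rewrite diracT mul1e big_ord0 !mul0r addr0.
  apply/measurable_EFinP/measurable_funX/measurable_funB => //.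
  exact: measurable_tuple_sum.
have mS m e : measurable_fun setT (fun w : m.-tuple T =>
    ((\sum_(i < m) f (tnth w i) - e) ^+ 2)%:E).
  apply/measurable_EFinP/measurable_funX/measurable_funB => //.
  exact: measurable_tuple_sum.
rewrite ge0_integral_product_powerS//; last by move=> w; rewrite lee_fin sqr_ge0.
apply: (@le_trans _ _ (\int[rho]_z ((f z - (c - n%:R * a)) ^+ 2 + n%:R * v)%:E)).
  under eq_integral do rewrite EFinD.
  rewrite ge0_integralD//; last 3 first.
  - by move=> z _; rewrite lee_fin sqr_ge0.
  - by apply/measurable_EFinP/measurable_funX/measurable_funB.
  - by move=> z _; rewrite lee_fin mulr_ge0.
  rewrite integral_probability_cst; apply: le_trans (leeD2r _ (fv _)).
  by rewrite -EFinD lee_fin -natr1 le_eqVlt; apply/orP; left; apply/eqP; ring.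
apply: ge0_le_integral => //.
- by move=> z _; rewrite lee_fin addr_ge0 ?sqr_ge0 ?mulr_ge0.
- apply/measurable_EFinP/measurable_funD => //.
  by apply/measurable_funX/measurable_funB.
- pose F (z : T * n.-tuple T) := ((\sum_(i < n.+1) f (tnth (cons_pair z) i) - c) ^+ 2)%:E.
  apply: (measurable_fun_fubini_tonelli_F (m2 := product_power rho n) F).
    exact: (measurableT_comp (mS n.+1 c) (@measurable_cons_pair _ _ n)).
  by move=> z; rewrite lee_fin sqr_ge0.
- move=> z _; rewrite (_ : _ + _ = (n%:R * a - (c - f z)) ^+ 2 + n%:R * v)%R; last by ring.
  apply: le_trans (ih _) _; rewrite le_eqVlt; apply/orP; left; apply/eqP.
  apply: eq_integral => w _; rewrite big_ord_recl /cons_pair tnth0/=; congr (_ ^+ 2)%:E.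
  under [in RHS]eq_bigr do rewrite tnthS.
  by rewrite opprB addrCA addrA.
Qed.
End product_power.

(** * Exchanging the expectation and the L^2 norm *)

(** Both integrals are suprema over the simple functions below the integrand,
whether or not it is measurable. *)
Lemma nonmeasurable_ge0_le_integral {R : realType} d (T : measurableType d)
    (m : {measure set T -> \bar R}) (f g : T -> \bar R) :
  (forall x, 0 <= f x)%E -> (forall x, f x <= g x)%E ->
  (\int[m]_x f x <= \int[m]_x g x)%E.
Proof.
move=> f0 fg; have g0 x : (0 <= g x)%E by exact: le_trans (f0 x) (fg x).
rewrite !ge0_integralTE//; apply: le_ereal_sup => _ [h hf <-]; exists h => // x.
exact: le_trans (hf x) (fg x).
Qed.

Section pointwise_risk.
Context {R : realType} d d' (T : measurableType d) (W : measurableType d').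
Variables (mu : {measure set T -> \bar R}) (P : probability W R).
Variables (G : W -> T -> R) (phi : T -> R).
Hypothesis mG : measurable_fun [set: W * T] (fun z => G z.1 z.2).
Hypothesis G2 : forall w, G w \in Lfun mu 2%:E.
Hypothesis iphi : mu.-integrable setT (EFin \o phi).
Hypothesis phi0 : forall t, 0 <= phi t.
Hypothesis phiG : forall t, ((phi t)%:E <= \int[P]_w (G w t ^+ 2)%:E)%E.

Let mphi : measurable_fun setT phi.
Proof. by case/integrableP : iphi => /measurable_EFinP. Qed.

Let S k := phi @^-1` `[k.+1%:R^-1, +oo[.

Let mS k : measurable (S k).
Proof. by rewrite -[X in measurable X]setTI; apply: mphi => //; exact: measurable_itv. Qed.

Let Sfin k : (mu (S k) < +oo)%E.
Proof.
have [_ phioo] := integrableP _ _ _ iphi.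
suff : (k.+1%:R^-1%:E * mu (S k) < +oo)%E.
  rewrite muleC; apply: contraTT; rewrite -!leNgt !leye_eq => /eqP ->.
  by rewrite gt0_mulye// lte_fin invr_gt0.
apply: le_lt_trans phioo; rewrite -integral_cst//.
apply: (@le_trans _ _ (\int[mu]_(t in S k) `|(phi t)%:E|)%E); last first.
  by apply: ge0_subset_integral => //; apply: measurableT_comp => //; exact/measurable_EFinP.
apply: ge0_le_integral => //.
- by move=> t _ /=; rewrite lee_fin invr_ge0.
- by apply: measurable_funTS; apply: measurableT_comp => //; exact/measurable_EFinP.
- by move=> t /=; rewrite /S /= in_itv/= andbT lee_fin ger0_norm.
Qed.

Let integral_truncated k :
  (\int[mu]_(t in S k) (phi t)%:E <= \int[P]_w (L2norm mu (G w) ^+ 2)%:E)%E.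
Proof.
pose m := mfrestr (mS k) (Sfin k).
have mm : (\int[mu]_(t in S k) (phi t)%:E = \int[m]_(t in S k) (phi t)%:E)%E.
  apply: eq_measure_integral => A mA AS.
  by rewrite /m /= /mfrestr /mrestr setIidl.
rewrite mm; apply: (@le_trans _ _ (\int[m]_t (phi t)%:E)%E).
  apply: ge0_subset_integral => //; first exact/measurable_EFinP.
  by move=> t _; rewrite lee_fin.
pose f (z : W * T) := (G z.1 z.2 ^+ 2)%:E.
have mf : measurable_fun setT f by exact/measurable_EFinP/measurable_funX.
have f0 z : (0 <= f z)%E by rewrite lee_fin sqr_ge0.
apply: (@le_trans _ _ (\int[m]_t \int[P]_w f (w, t))%E).
  apply: ge0_le_integral => //.
  - by move=> t _; rewrite lee_fin.
  - exact/measurable_EFinP.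
  - exact: measurable_fun_fubini_tonelli_G.
rewrite -(fubini_tonelli (m1 := P) (m2 := m))//.
apply: nonmeasurable_ge0_le_integral => w; first by apply: integral_ge0.
rewrite L2norm_sqr//; apply: ge0_le_measure_integral => //.
- by move=> A mA; rewrite /m /= /mfrestr /mrestr le_measure// ?inE//; exact: measurableI.
- exact/measurable_EFinP/measurable_funX/Lfun_measurable/G2.
Qed.

(** Tonelli's theorem for the square of an [L^2] norm, as an inequality.  As [mu]
need not be sigma-finite, the squared norm need not be a measurable function of
the sample; but an integrable lower bound vanishes outside a sigma-finite set,
on which Tonelli's theorem holds. *)
Lemma integral_pointwise_risk_le :
  (\int[mu]_t (phi t)%:E <= \int[P]_w (L2norm mu (G w) ^+ 2)%:E)%E.
Proof.
have -> : (\int[mu]_t (phi t)%:E = \int[mu]_(t in \bigcup_k S k) (phi t)%:E)%E.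
  rewrite [RHS]integral_mkcond; apply: eq_integral => t _; rewrite patchE.
  case: ifPn => // /negP; rewrite inE => Nt; congr EFin.
  apply/eqP; rewrite eq_le phi0 andbT leNgt; apply/negP => pt; apply: Nt.
  exists (Num.bound (phi t)^-1) => //; rewrite /S /= in_itv/= andbT.
  rewrite invf_ple ?posrE//; apply/ltW/(lt_trans (archi_boundP _)).
    by rewrite invr_ge0.
  by rewrite ltr_nat.
apply: (cvge_le _ (ge0_nondecreasing_set_cvg_integral _ _ _ _)) => //.
- by apply: nearW => k; exact: integral_truncated.
- move=> i j ij; rewrite subsetEset => t; rewrite /S /= !in_itv/= !andbT.
  by apply: le_trans; rewrite lef_pV2 ?posrE// ler_nat ltnS.
- by move=> i; exact/measurable_funTS/measurable_EFinP.
- by move=> i t _; rewrite lee_fin.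
Qed.

End pointwise_risk.

(** * Risk of the estimator *)

Section estimator_risk.
Context {R : realType} d1 d2 (T : measurableType d1) (X : measurableType d2).
Variables (mu : {measure set T -> \bar R}).
Variables (rho : probability (X * measurableTypeR R)%type R) (nu : probability X R).
Hypothesis nuE : forall B, measurable B -> nu B = rho (B `*` setT).
Variables (y : X -> R) (sigma : R).
Hypothesis y2 : y \in Lfun nu 2%:E.
Hypothesis hmean : conditional_expectation rho nu (fun z => z.2) y.
Hypothesis hvar : conditional_expectation rho nu
  (fun z => (z.2 - y z.1) ^+ 2) (cst (sigma ^+ 2)).
Variables (l : R -> X -> T -> R) (la : R) (fd : T -> R).
Hypothesis hl : regularization_kernel mu nu l.
Hypothesis la0 : 0 < la.
Hypothesis fd2 : fd \in Lfun mu 2%:E.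
Let L := kernel_operator nu l la.
Hypothesis hL : bounded_linear_L2 nu mu L.

Let l_x x : l la x \in Lfun mu 2%:E. Proof. by case: (hl la0). Qed.
Let l_t t : l la ^~ t \in Lfun nu 2%:E. Proof. by case: (hl la0). Qed.
Let ml : measurable_fun [set: X * T] (fun z => l la z.1 z.2).
Proof. by case: (hl la0). Qed.
Let L2 z : z \in Lfun nu 2%:E -> L z \in Lfun mu 2%:E.
Proof. by case: hL => + _ _; apply. Qed.

Let err n (w : n.-tuple (X * measurableTypeR R)) := estimator l la w \- fd.

Lemma estimator_Lfun n (w : n.-tuple (X * measurableTypeR R)) :
  estimator l la w \in Lfun mu 2%:E.
Proof.
apply: LfunZ; rewrite (_ : (fun t => _) = fun t =>
    \sum_(i <- index_enum 'I_n) (tnth w i).2 * l la (tnth w i).1 t).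
  exact: Lfun_linear_combination.
by apply/funext => t; apply: eq_bigr => i _; rewrite mulrC.
Qed.

Lemma measurable_estimator n : measurable_fun
  [set: n.-tuple (X * measurableTypeR R) * T] (fun z => estimator l la z.1 z.2).
Proof.
apply: measurable_funM => //; apply: measurable_sum => i.
have mt : measurable_fun [set: n.-tuple (X * measurableTypeR R) * T]
    (fun z => tnth z.1 i).
  exact: (measurableT_comp (measurable_tnth i) measurable_fst).
apply: measurable_funM; last exact: measurableT_comp measurable_snd mt.
apply: (measurableT_comp ml (g := fun z : n.-tuple (X * measurableTypeR R) * T => ((tnth z.1 i).1, z.2))).
by apply: measurable_fun_pair; [exact: measurableT_comp measurable_fst mt|exact: measurable_snd].
Qed.

Lemma estimator_pointwise_risk_ge n t : (0 < n)%N ->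
  (((L y t - fd t) ^+ 2 + sigma ^+ 2 / n%:R * L2norm nu (l la ^~ t) ^+ 2)%:E <=
   \int[product_power rho n]_w ((estimator l la w t - fd t) ^+ 2)%:E)%E.
Proof.
move=> n0; have n0' : n%:R != 0 :> R by rewrite pnatr_eq0 -lt0n.
pose f (z : X * measurableTypeR R) := l la z.1 t * z.2.
have mf : measurable_fun setT f.
  apply: measurable_funM; last exact: measurable_snd.
  exact: measurableT_comp (Lfun_measurable (l_t t)) measurable_fst.
have v0 : 0 <= sigma ^+ 2 * L2norm nu (l la ^~ t) ^+ 2 by rewrite mulr_ge0// sqr_ge0.
have := product_power_sqr_risk_ge (a := L y t) mf v0
  (fun c => single_observation_sqr_risk_ge nuE y2 hmean hvar c (l_t t)) n (n%:R * fd t).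
have n2 : (0 <= (n%:R ^- 2)%:E :> \bar R)%E by rewrite lee_fin invr_ge0 sqr_ge0.
move=> /(lee_wpmul2l n2); rewrite -ge0_integralZl_EFin//; last 2 first.
- by move=> w _; rewrite lee_fin sqr_ge0.
- apply/measurable_EFinP/measurable_funX/measurable_funB => //.
  exact: measurable_tuple_sum.
rewrite -EFinM [X in (X%:E <= _)%E -> _](_ : _ = (L y t - fd t) ^+ 2 +
    sigma ^+ 2 / n%:R * L2norm nu (l la ^~ t) ^+ 2); last by field.
move=> /le_trans; apply; rewrite le_eqVlt; apply/orP; left; apply/eqP.
apply: eq_integral => w _; rewrite -EFinM /estimator; congr EFin.
by rewrite /f; set S := \sum_(i < n) _; field.
Qed.

(** Bias-variance inequality: the noise alone makes the variance of the estimator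
at least [sigma ^ 2 / n] times the squared Hilbert-Schmidt norm.  Bessel's
inequality is applied to the sections of the kernel, with finitely many vectors
of an orthonormal basis at a time. *)
Lemma estimator_risk_ge n : (0 < n)%N -> sigma != 0 -> 0 < HSnorm mu nu L ->
  ((L2norm mu (L y \- fd) ^+ 2 + sigma ^+ 2 / n%:R * HSnorm mu nu L ^+ 2)%:E <=
   'E_(product_power rho n)[fun w => (L2norm mu (estimator l la w \- fd) ^+ 2)%R])%E.
Proof.
move=> n0 sigma0 /HSnorm_gt0P[B [[B2 B1 Bo _] _ HS]].
have k0 : 0 < sigma ^+ 2 / n%:R by rewrite divr_gt0 ?exprn_even_gt0 ?ltr0n.
have Lyfd : L y \- fd \in Lfun mu 2%:E by apply: LfunB => //; exact: L2.
rewrite unlock; set r := integral _ _ _.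
have finite_family s : uniq s -> (forall b, b \in s -> B b) ->
    ((L2norm mu (L y \- fd) ^+ 2 +
      sigma ^+ 2 / n%:R * \sum_(b <- s) L2norm mu (L b) ^+ 2)%:E <= r)%E.
  move=> us sB.
  have Lb b : b \in s -> L b \in Lfun mu 2%:E by move=> /sB/B2/L2.
  have i1 := Lfun2_integrable_sqr Lyfd; have [i2 e2] := sum_sqr_integral Lb.
  have i3 := integrableZl measurableT (sigma ^+ 2 / n%:R) i2.
  pose phi t := (L y \- fd) t ^+ 2 + sigma ^+ 2 / n%:R * \sum_(b <- s) L b t ^+ 2.
  have iphi : mu.-integrable setT (EFin \o phi) := integrableD measurableT i1 i3.
  have -> : (L2norm mu (L y \- fd) ^+ 2 +
      sigma ^+ 2 / n%:R * \sum_(b <- s) L2norm mu (L b) ^+ 2)%:E = (\int[mu]_t (phi t)%:E)%E.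
    rewrite (integralD measurableT i1 i3) (integralZl measurableT i2) /= e2.
    by rewrite -L2norm_sqr.
  apply: (integral_pointwise_risk_le (G := @err n) _ _ iphi).
  - apply: measurable_funB; first exact: measurable_estimator.
    exact: measurableT_comp (Lfun_measurable fd2) measurable_snd.
  - by move=> w; apply: LfunB => //; exact: estimator_Lfun.
  - move=> t; rewrite /phi addr_ge0 ?sqr_ge0// mulr_ge0 ?(ltW k0)//.
    by apply: sumr_ge0 => b _; exact: sqr_ge0.
  - move=> t; apply: le_trans (estimator_pointwise_risk_ge t n0).
    rewrite lee_fin lerD2l ler_pM2l//.
    exact: (Bessel_inequality B2 B1 Bo (l_t t) us sB).
have r0 : (0 <= r)%E by apply: integral_ge0 => w _; rewrite lee_fin sqr_ge0.
have [->|roo] := eqVneq r +oo%E; first exact: leey.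
have rE : r = (fine r)%:E by rewrite fineK// ge0_fin_numE// lt_neqAle roo leey.
rewrite rE lee_fin -lerBrDl mulrC -ler_pdivlMr//; apply: HS => s us sB.
by rewrite ler_pdivlMr// mulrC lerBrDl -lee_fin -rE; exact: finite_family.
Qed.

End estimator_risk.

(** With [H] the Hilbert-Schmidt norm of [L], both sides are compared with
[H^2 (e + d)^2]: the equation for [d] turns the bias-variance bound of the risk
into this quantity, and [L z - fd] is the sum of [L y - fd], of norm [H e], and of
[L (z - y)], of norm at most [H d]. *)
Lemma estimator_risk_ge_deterministic (R : realType)
  (d1 d2 : measure_display) (T : measurableType d1) (X : measurableType d2)
  (mu : {measure set T -> \bar R})
  (rho : probability (X * measurableTypeR R)%type R) (nu : probability X R)
  (nuE : forall B, measurable B -> nu B = rho (B `*` setT))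
  (l : R -> X -> T -> R) (hl : regularization_kernel mu nu l)
  (y : X -> R) (hy : y \in Lfun nu 2%:E)
  (fd : T -> R) (fd2 : fd \in Lfun mu 2%:E)
  (sigma : R)
  (hmean : conditional_expectation rho nu (fun z => z.2) y)
  (hvar : conditional_expectation rho nu
    (fun z => (z.2 - y z.1) ^+ 2) (cst (sigma ^+ 2)))
  (la d : R) (n : nat) (z : X -> R) :
  let L := kernel_operator nu l la in
  let e := L2norm mu (L y \- fd) / HSnorm mu nu L in
  0 < la -> bounded_linear_L2 nu mu L -> (0 < n)%N -> sigma != 0 ->
  0 < HSnorm mu nu L -> 0 < d -> d ^+ 2 + 2 * d * e = sigma ^+ 2 / n%:R ->
  z \in Lfun nu 2%:E -> L2norm nu (z \- y) <= d ->
  ((L2norm mu (L z \- fd) ^+ 2)%:E <= 'E_(product_power rho n)[fun w =>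
      (L2norm mu (estimator l la w \- fd) ^+ 2)%R])%E.
Proof.
move=> L e la0 bL n0 sigma0 H0 d0 dE z2 zd.
apply: le_trans (estimator_risk_ge nuE hy hmean hvar hl la0 fd2 bL n0 sigma0 H0).
have [L2 lin _] := bL.
have zy2 : z \- y \in Lfun nu 2%:E by exact: LfunB.
have Lyfd2 : L y \- fd \in Lfun mu 2%:E by apply: LfunB => //; exact: L2.
have biasE : L2norm mu (L y \- fd) = e * HSnorm mu nu L.
  by rewrite /e divfK// gt_eqF.
have e0 : 0 <= e by rewrite divr_ge0 ?L2norm_ge0 ?sqrtr_ge0.
have Lz : L2norm mu (L z \- fd) <= (e + d) * HSnorm mu nu L.
  have zE : z = fun x => 1 * (z \- y) x + y x by apply/funext => x /=; ring.
  have Lzy2 := L2 _ zy2.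
  rewrite (ae_eq_L2norm (g := L (z \- y) \+ (L y \- fd))).
  - apply: le_trans (ler_L2normD Lzy2 Lyfd2) _; rewrite biasE mulrDl addrC lerD2l mulrC.
    apply: le_trans (L2norm_operator_HSnorm bL H0 zy2) _.
    by rewrite ler_wpM2l// ltW.
  - by apply: LfunB => //; exact: L2.
  - exact: LfunD.
  - have := lin 1 _ _ zy2 hy; rewrite -zE; apply: filterS => t /= /(_ I) -> _.
    by ring.
rewrite lee_fin biasE -dE.
rewrite (_ : _ + _ = ((e + d) * HSnorm mu nu L) ^+ 2); last by ring.
by rewrite lerXn2r// nnegrE ?L2norm_ge0// mulr_ge0 ?addr_ge0// ltW.
Qed.

(** * Rates of the noise level *)

Section rates.
Context {R : realType}.
Implicit Types (d e k q r s A B : R).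

(** Multiplying by the conjugate, the level is [sqrt (sigma^2 / n + e^2) - e]. *)
Lemma noise_levelP (sigma : R) (eps : R -> R) n la :
  sigma != 0 -> (0 < n)%N -> 0 <= eps la ->
  let d := noise_level sigma eps n la in
  0 < d /\ d ^+ 2 + 2 * d * eps la = sigma ^+ 2 / n%:R.
Proof.
move=> sigma0 n0 e0 /=; rewrite /noise_level.
set e := eps la in e0 *; set k := sigma ^+ 2 / n%:R.
have k0 : 0 < k by rewrite divr_gt0 ?exprn_even_gt0 ?ltr0n.
have ke0 : 0 < k + e ^+ 2 by rewrite ltr_wpDr// sqr_ge0.
have q0 : 0 < Num.sqrt (k + e ^+ 2) by rewrite sqrtr_gt0.
have q2 : Num.sqrt (k + e ^+ 2) ^+ 2 = k + e ^+ 2 by rewrite sqr_sqrtr// ltW.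
set q := Num.sqrt _ in q0 q2 *.
have qe0 : 0 < q + e by rewrite ltr_wpDr.
have -> : (q + e)^-1 * k = q - e.
  apply: (mulfI (lt0r_neq0 qe0)); rewrite mulrA mulfV ?gt_eqF// mul1r.
  by rewrite -[LHS](addrK (e ^+ 2)) -q2; ring.
split; last by rewrite (_ : k = q ^+ 2 - e ^+ 2); [ring|rewrite q2 addrK].
by rewrite subr_gt0 -(ltr_pXn2r (n := 2)) ?nnegrE ?(ltW q0)// q2 ltrDr.
Qed.

(** For small [d], the error [e ~ d^q] is at most of the order of [d] when [1 <= q]
and dominates [d] when [q < 1]: this is where the two regimes come from. *)
Lemma noise_power_bounds q d e k A B :
  0 < d <= 1 -> 0 < A -> 0 < B -> A * d `^ q <= e <= B * d `^ q ->
  d ^+ 2 + 2 * d * e = k ->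
  (1 <= q -> 1 * d `^ 2 <= k <= (1 + 2 * B) * d `^ 2) /\
  (q < 1 -> (2 * A) * d `^ (1 + q) <= k <= (1 + 2 * B) * d `^ (1 + q)).
Proof.
move=> d01 A0 B0 /andP[Ae eB] <-; have [d0 d1] := andP d01.
have dq0 := powR_ge0 d q.
have d1q : d `^ (1 + q) = d * d `^ q.
  by rewrite powRD ?powRr1 ?(ltW d0)// (gt_eqF d0) implybT.
rewrite (powR_mulrn 2 (ltW d0)) d1q.
have e0 : 0 <= e by apply: le_trans Ae; rewrite mulr_ge0// ltW.
have de0 : 0 <= d * e by rewrite mulr_ge0// ltW.
have deA := ler_wpM2l (ltW d0) Ae; have deB := ler_wpM2l (ltW d0) eB.
split=> q1; apply/andP; split.
- by rewrite mul1r lerDl -mulrA mulr_ge0.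
- have dq : d `^ q <= d by exact: ge1r_powR.
  have := ler_wpM2l (ltW d0) (ler_wpM2l (ltW B0) dq); nra.
- have := sqr_ge0 d; nra.
- have dq : d <= d `^ q by apply: ger1_powR => //; exact: ltW.
  have := ler_wpM2l (ltW d0) dq; nra.
Qed.

Lemma powR_sandwich r s d k A B : 0 < r -> 0 <= s -> 0 < A -> 0 < B ->
  0 < d -> 0 < k -> A * d `^ r <= k <= B * d `^ r ->
  (k / B) `^ (s / r) <= d `^ s <= (k / A) `^ (s / r).
Proof.
move=> r0 s0 A0 B0 d0 k0 /andP[Ak kB].
have -> : d `^ s = (d `^ r) `^ (s / r) by rewrite -powRrM mulrC divfK// gt_eqF.
have sr0 : 0 <= s / r by rewrite divr_ge0// ltW.
apply/andP; split; apply: ge0_ler_powR; rewrite ?nnegrE ?powR_ge0//.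
- by rewrite divr_ge0// ltW.
- by rewrite ler_pdivrMr// mulrC.
- by rewrite divr_ge0// ltW.
- by rewrite ler_pdivlMr// mulrC.
Qed.

Lemma noise_level_rate (dt : nat -> R) (v r s A B : R) :
  0 < v -> 0 < r -> 0 <= s -> 0 < A -> 0 < B ->
  (\forall n \near \oo, 0 < dt n /\ A * dt n `^ r <= v / n%:R <= B * dt n `^ r) ->
  exists m M : R, [/\ 0 < m, 0 < M & \forall n \near \oo,
    m * n%:R `^ (- (s / r)) <= dt n `^ s <= M * n%:R `^ (- (s / r))].
Proof.
move=> v0 r0 s0 A0 B0 H.
exists ((v / B) `^ (s / r)), ((v / A) `^ (s / r)).
split; rewrite ?powR_gt0 ?divr_gt0//.
near=> n; have n0 : (0 < n)%N by near: n; exact: nbhs_infty_gt.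
have [d0 hd] : 0 < dt n /\ A * dt n `^ r <= v / n%:R <= B * dt n `^ r by near: n.
have vn0 : 0 < v / n%:R by rewrite divr_gt0// ltr0n.
have := powR_sandwich r0 s0 A0 B0 d0 vn0 hd.
have nE C : 0 < C -> (v / n%:R / C) `^ (s / r) = (v / C) `^ (s / r) * n%:R `^ (- (s / r)).
  move=> C0; rewrite mulrAC [LHS]powRM ?divr_ge0 ?(ltW v0) ?(ltW C0) ?invr_ge0//.
  by congr (_ * _); rewrite -[n%:R^-1]powR_inv1// -powRrM mulN1r.
by rewrite !nE.
Unshelve. all: by end_near. Qed.

Lemma near_at_right0P (P : R -> Prop) :
  (\forall x \near 0^'+, P x) -> exists2 e : R, 0 < e & forall x, 0 < x -> x < e -> P x.
Proof.
move=> [e /= e0 He]; exists e => // x x0 xe; apply: He => //=.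
by rewrite sub0r normrN gtr0_norm.
Qed.

Lemma bigTheta_of_bounds (F : set_system nat) (f g : nat -> R) m M : Filter F ->
  0 < m -> 0 < M -> (\forall n \near F, 0 <= f n) -> (forall n, 0 <= g n) ->
  (\forall n \near F, m * g n <= f n <= M * g n) -> f \is 'Theta_F g.
Proof.
move=> FF m0 M0 f0 g0 fg; rewrite qualifE; apply/asboolP.
exists (m, M) => /=; first by rewrite m0.
near=> n; have fn : 0 <= f n by near: n.
have : m * g n <= f n <= M * g n by near: n.
by rewrite (ger0_norm fn) (ger0_norm (g0 n)) => /andP.
Unshelve. all: by end_near. Qed.

End rates.

Section associated_choice.
Context {R : realType}.
Variables (sigma : R) (eps lad : R -> R) (lan : nat -> R).
Hypothesis hlan : associated_choice sigma eps lad lan.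

Lemma associated_choiceE n : (0 < n)%N -> lan n = lad (noise_level sigma eps n (lan n)).
Proof. by case: hlan => h1 h2 n0; rewrite h2// h1. Qed.

(** Without noise the sample size attached to a noise level would be zero. *)
Lemma associated_choice_sigma_neq0 : sigma != 0.
Proof.
apply/eqP => s0; case: hlan => /(_ 1%N isT) + _.
by rewrite s0 /sample_size expr0n/= !mul0r truncn0.
Qed.

Lemma noise_level_lt e : (forall la, 0 <= eps la) -> 0 < e ->
  \forall n \near \oo, (0 < n)%N /\ 0 < noise_level sigma eps n (lan n) < e.
Proof.
move=> eps0 e0; near=> n; have n0 : (0 < n)%N by near: n; exact: nbhs_infty_gt.
have [d0 dE] := noise_levelP associated_choice_sigma_neq0 n0 (eps0 (lan n)).
split=> //; rewrite d0/= -(ltr_pXn2r (n := 2)) ?nnegrE ?(ltW d0) ?(ltW e0)//.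
apply: (@le_lt_trans _ _ (sigma ^+ 2 / n%:R)).
  by rewrite -dE lerDl mulr_ge0// mulr_ge0// ltW.
rewrite ltr_pdivrMr ?ltr0n// -ltr_pdivrMl ?exprn_gt0// mulrC.
apply: lt_le_trans (archi_boundP _) _; first by rewrite divr_ge0// sqr_ge0.
by rewrite ler_nat; near: n; exact: nbhs_infty_ge.
Unshelve. all: by end_near. Qed.

(** Along the associated choice the noise level [d] satisfies
[d^2 + 2 d eps (lad d) = sigma^2 / n], where [eps (lad d)] is of order
[d^(p gamma)]; solving for [d] gives its rate, and that of all its powers.  The
exponent [r] is kept abstract so that both regimes are treated at once.  The
positivity of [eps] is recorded to exclude a degenerate Hilbert-Schmidt norm. *)
Lemma associated_choice_rates (p gamma : R) : 0 < p -> 0 < gamma ->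
  (forall la, 0 <= eps la) -> (forall d, 0 < d -> 0 < lad d) ->
  lad \is 'Theta_(0^'+) (fun d => d `^ p) ->
  eps \is 'Theta_(0^'+) (fun la => la `^ gamma) ->
  exists r, [/\ 0 < r, (1 <= p * gamma -> r = 2), (p * gamma < 1 -> r = 1 + p * gamma),
    (\forall d \near 0^'+, 0 < eps (lad d)) &
    forall s, 0 <= s -> exists m M : R, [/\ 0 < m, 0 < M & \forall n \near \oo,
    m * n%:R `^ (- (s / r)) <= noise_level sigma eps n (lan n) `^ s
      <= M * n%:R `^ (- (s / r))]].
Proof.
move=> p0 gamma0 eps0 lad0.
rewrite !qualifE => /asboolP[[/= k1 k2] /andP[k10 k20] Hlad].
move=> /asboolP[[/= c1 c2] /andP[c10 c20] Heps].
have [e1 e10 {}Heps] := near_at_right0P Heps.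
have [e2 e20 {}Hlad] := near_at_right0P Hlad.
have ladP d : 0 < d -> d < e2 -> k1 * d `^ p <= lad d <= k2 * d `^ p.
  move=> d0 de; have [] := Hlad _ d0 de.
  by rewrite (ger0_norm (powR_ge0 _ _)) (gtr0_norm (lad0 _ d0)) => -> ->.
have epsP la : 0 < la -> la < e1 -> c1 * la `^ gamma <= eps la <= c2 * la `^ gamma.
  move=> l0 le1; have [] := Heps _ l0 le1.
  by rewrite (ger0_norm (powR_ge0 _ _)) (ger0_norm (eps0 _)) => -> ->.
(* below this threshold [lad d] is small enough for the bounds on [eps] *)
pose e3 := Num.min (Num.min e2 1) ((e1 / k2) `^ p^-1).
have e30 : 0 < e3 by rewrite !lt_min e20 ltr01 powR_gt0// divr_gt0.
pose A := c1 * k1 `^ gamma; pose B := c2 * k2 `^ gamma.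
have A0 : 0 < A by rewrite mulr_gt0// powR_gt0.
have B0 : 0 < B by rewrite mulr_gt0// powR_gt0.
have epsladP d : 0 < d -> d < e3 -> A * d `^ (p * gamma) <= eps (lad d) <= B * d `^ (p * gamma).
  move=> d0; rewrite !lt_min => /andP[/andP[de2 _] de1].
  have /andP[l1 l2] := ladP _ d0 de2; have l0 := lad0 _ d0.
  have le1 : lad d < e1.
    apply: le_lt_trans l2 _; rewrite mulrC -ltr_pdivlMr//.
    have := gt0_ltr_powR p0 _ _ de1; rewrite !nnegrE powR_ge0 (ltW d0) => /(_ isT isT).
    by rewrite -powRrM mulVf ?gt_eqF// powRr1// divr_ge0// ltW.
  have /andP[h1 h2] := epsP _ l0 le1.
  have pg k : 0 < k -> k `^ gamma * d `^ (p * gamma) = (k * d `^ p) `^ gamma.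
    by move=> k0; rewrite powRM ?powR_ge0 ?(ltW k0)// powRrM.
  rewrite /A /B -!mulrA !pg//; apply/andP; split.
    apply: le_trans h1; rewrite ler_pM2l//; apply: ge0_ler_powR => //; first exact: ltW.
      by rewrite nnegrE mulr_ge0 ?powR_ge0// ltW.
    by rewrite nnegrE ltW.
  apply: le_trans h2 _; rewrite ler_pM2l//; apply: ge0_ler_powR => //; first exact: ltW.
    by rewrite nnegrE ltW.
  by rewrite nnegrE mulr_ge0 ?powR_ge0// ltW.
have epspos : \forall d \near 0^'+, 0 < eps (lad d).
  near=> d; have d0 : 0 < d by [].
  have /andP[+ _] : A * d `^ (p * gamma) <= eps (lad d) <= B * d `^ (p * gamma).
    by apply: epsladP => //; near: d; exact: nbhs_right_lt.
  by apply: lt_le_trans; rewrite mulr_gt0// powR_gt0.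
have sigma0 := associated_choice_sigma_neq0.
have v0 : 0 < sigma ^+ 2 by rewrite exprn_even_gt0.
have bounds : \forall n \near \oo, let d := noise_level sigma eps n (lan n) in 0 < d /\
    ((1 <= p * gamma -> 1 * d `^ 2 <= sigma ^+ 2 / n%:R <= (1 + 2 * B) * d `^ 2) /\
    (p * gamma < 1 -> (2 * A) * d `^ (1 + p * gamma) <= sigma ^+ 2 / n%:R <=
       (1 + 2 * B) * d `^ (1 + p * gamma))).
  have := noise_level_lt eps0 e30; apply: filterS => n [n0 /andP[d0 de]] /=.
  have [_ dE] := noise_levelP sigma0 n0 (eps0 (lan n)).
  split=> //; apply: noise_power_bounds dE => //.
    by rewrite d0/=; move: de; rewrite !lt_min => /andP[/andP[_ /ltW]].
  by rewrite [eps (lan n)](_ : _ = eps (lad (noise_level sigma eps n (lan n)))) ?epsladP// -associated_choiceE.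
have B1 : 0 < 1 + 2 * B by rewrite addr_gt0// mulr_gt0.
have [pg|pg] := leP 1 (p * gamma).
- exists 2; split=> // s s0; apply: (noise_level_rate (A := 1) (B := 1 + 2 * B) v0) => //.
  by apply: filterS bounds => n /= [d0 [/(_ pg)]].
- have r0 : 0 < 1 + p * gamma by rewrite addr_gt0// mulr_gt0.
  exists (1 + p * gamma); split=> // s s0; apply: (noise_level_rate (A := 2 * A) (B := 1 + 2 * B) v0) => //.
    by rewrite mulr_gt0.
  by apply: filterS bounds => n /= [d0 [_ /(_ pg)]].
Unshelve. all: by end_near. Qed.

End associated_choice.

(** * The lower rate *)

Theorem theorem5 (R : realType)
  (d1 d2 : measure_display) (T : measurableType d1) (X : measurableType d2)
  (mu : {measure set T -> \bar R})
  (rho : probability (X * measurableTypeR R)%type R) (nu : probability X R)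
  (nuE : forall B, measurable B -> nu B = rho (B `*` setT))
  (A : (T -> R) -> (X -> R)) (hA : bounded_linear_L2 mu nu A)
  (l : R -> X -> T -> R) (hl : regularization_kernel mu nu l)
  (hL : linear_regularization mu nu A (kernel_operator nu l))
  (y : X -> R) (hy : y \in Lfun nu 2%:E)
  (fd : T -> R) (hfd : generalized_solution mu nu A y fd)
  (hAfd : A fd = y %[ae nu])
  (sigma : R)
  (hmean : conditional_expectation rho nu (fun z => z.2) y)
  (hvar : conditional_expectation rho nu
    (fun z => (z.2 - y z.1) ^+ 2) (cst (sigma ^+ 2)))
  (alpha p gamma : R)
  (halpha : 0 < alpha) (hp : 0 < p) (hgamma : 0 < gamma)
  (yd : R -> X -> R)
  (hyd : forall d, 0 < d ->
    yd d \in Lfun nu 2%:E /\ L2norm nu (yd d \- y) <= d)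
  (lad : R -> R) (lad_gt0 : forall d, 0 < d -> 0 < lad d)
  (lan : nat -> R) :
  let L := kernel_operator nu l in
  let eps := fun la => L2norm mu (L la y \- fd) / HSnorm mu nu (L la) in
  let risk := fun n =>
    'E_(product_power rho n)[fun w =>
      (L2norm mu (estimator l (lan n) w \- fd) ^+ 2)%R]%E in
  lad \is 'Theta_(0^'+) (fun d => d `^ p) ->
  eps \is 'Theta_(0^'+) (fun la => la `^ gamma) ->
  (fun d => L2norm mu (L (lad d) (yd d) \- fd) ^+ 2)
    \is 'Omega_(0^'+) (fun d => d `^ alpha) ->
  associated_choice sigma eps lad lan ->
  (1 <= p * gamma ->
    is_bigOmega_ereal \oo risk (fun n => n%:R `^ (- (alpha / 2))) /\
    lan \is 'Theta_\oo (fun n => n%:R `^ (- (p / 2)))) /\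
  (p * gamma < 1 ->
    is_bigOmega_ereal \oo risk
      (fun n => n%:R `^ (- (alpha / (1 + p * gamma)))) /\
    lan \is 'Theta_\oo (fun n => n%:R `^ (- (p / (1 + p * gamma))))).
Proof.
move=> L eps risk Hlad Heps Homega Hlan.
have eps0 la : 0 <= eps la by rewrite divr_ge0 ?L2norm_ge0 ?sqrtr_ge0.
have [[fd2 _] _] := hfd; have [bL _] := hL.
have sigma0 := associated_choice_sigma_neq0 Hlan.
have [r [r0 r2 r1 epspos rates]] :=
  associated_choice_rates Hlan hp hgamma eps0 lad_gt0 Hlad Heps.
pose dt n := noise_level sigma eps n (lan n).
have lan_rate : lan \is 'Theta_\oo (fun n => n%:R `^ (- (p / r))).
  move: Hlad; rewrite qualifE => /asboolP[[/= k1 k2] /andP[k10 k20] Hlad].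
  have [m [M [m0 M0 mM]]] := rates _ (ltW hp).
  have [e e0 {}Hlad] := near_at_right0P Hlad.
  have lan0 : \forall n \near \oo, 0 < lan n /\
      k1 * dt n `^ p <= lan n <= k2 * dt n `^ p.
    have := noise_level_lt Hlan eps0 e0; apply: filterS => n [n0 /andP[d0 de]].
    rewrite (associated_choiceE Hlan n0); have l0 := lad_gt0 _ d0; split=> //.
    have [] := Hlad _ d0 de; rewrite (gtr0_norm l0) (ger0_norm (powR_ge0 _ _)) /dt.
    by rewrite -(associated_choiceE Hlan n0) => -> ->.
  apply: (bigTheta_of_bounds (m := k1 * m) (M := k2 * M)); rewrite ?mulr_gt0//.
  - by apply: filterS lan0 => n [/ltW].
  - apply: filterS2 lan0 mM => n [_ /andP[l1 l2]] /andP[h1 h2].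
    rewrite -!mulrA; apply/andP; split.
      by apply: le_trans l1; rewrite ler_pM2l.
    by apply: le_trans l2 _; rewrite ler_pM2l.
have risk_rate : is_bigOmega_ereal \oo risk (fun n => n%:R `^ (- (alpha / r))).
  move: Homega; rewrite qualifE => /asboolP[/= k k0 Homega].
  have [m [M [m0 M0 mM]]] := rates _ (ltW halpha).
  have [e e0 He] := near_at_right0P (filterI epspos Homega).
  exists (k * m); first exact: mulr_gt0.
  apply: filterS2 (noise_level_lt Hlan eps0 e0) mM => n [n0 /andP[d0 de]] /andP[h1 _].
  have [epos Om] := He _ d0 de.
  have lanE := associated_choiceE Hlan n0.
  rewrite -lanE in epos Om.
  have lan0 : 0 < lan n by rewrite lanE; exact: lad_gt0.
  have H0 : 0 < HSnorm mu nu (L (lan n)).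
    (* otherwise the ratio [eps] would vanish, being a division by zero *)
    rewrite lt_neqAle sqrtr_ge0 andbT eq_sym; apply/eqP => H0.
    by move: epos; rewrite /eps H0 invr0 mulr0 ltxx.
  have [yd2 ydd] := hyd _ d0.
  have [_ dE] := noise_levelP sigma0 n0 (eps0 (lan n)).
  apply: le_trans (estimator_risk_ge_deterministic nuE hl hy fd2 hmean hvar lan0
    (bL _ lan0) n0 sigma0 H0 d0 dE yd2 ydd).
  rewrite lee_fin; move: Om.
  rewrite (ger0_norm (powR_ge0 _ _)) (ger0_norm (sqr_ge0 _)); apply: le_trans.
  by rewrite -mulrA ler_pM2l.
split=> pg; first by move: risk_rate lan_rate; rewrite (r2 pg).
by move: risk_rate lan_rate; rewrite (r1 pg).
Qed.
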